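(* Let $\lambda\in\mathbb{R}$ be fixed and set $p=\frac{1+\lambda n^{-1/3}}{n}$. Consider the random graph $G(n,p)$, let $\mathcal{C}_1$ denote its largest connected component, and let $C(v)$ denote the connected component containing a vertex $v$. (i) If $\lambda>0$ and $A>2\lambda+3$, then for all large enough $n$ $$\mathbf{P}\big(|C(v)|\ge An^{2/3}\big)\le\Big(\frac{4\lambda}{1-e^{-4\lambda}}+16\Big)n^{-1/3}\,e^{-\frac{((A-1)^2/2-(A-1)\lambda-2)^2}{4A}}$$ and $$\mathbf{P}\big(|\mathcal{C}_1|\ge An^{2/3}\big)\le\Big(\frac{4\lambda}{A(1-e^{-4\lambda})}+\frac{16}{A}\Big)\,e^{-\frac{((A-1)^2/2-(A-1)\lambda-2)^2}{4A}}.$$ (ii) If $\lambda<0$ and $A>3$, then for all large enough $n$ $$\mathbf{P}\big(|C(v)|\ge An^{2/3}\big)\le\Big(\frac{-2\lambda}{e^{-\lambda}-1}+\min\big(5,-\tfrac1\lambda\big)\Big)n^{-1/3}\,e^{-\frac{((A-1)^2/2-(A-1)\lambda-2)^2}{4A}}$$ and $$\mathbf{P}\big(|\mathcal{C}_1|\ge An^{2/3}\big)\le\Big(\frac{-2\lambda}{A(e^{-\lambda}-1)}+\min\big(5,-\tfrac1\lambda\big)\Big)\,e^{-\frac{((A-1)^2/2-(A-1)\lambda-2)^2}{4A}}.$$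
   Context: The random graph $G(n,p)$ is obtained from the complete graph on $n$ (labelled) vertices by independently retaining each edge with probability $p$ and deleting it with probability $1-p$. For a connected component $C$, $|C|$ denotes its number of vertices; $|\mathcal{C}_1|$ is the maximal number of vertices in a connected component. The vertex $v$ is an arbitrary fixed (deterministic) vertex. ''For all large enough $n$'' means for all $n\ge n_0$ with $n_0$ depending on the fixed numbers $\lambda$ and $A$ (in particular $n$ is large enough that $p\in[0,1]$). *)

(* Defs.v *)
From mathcomp Require Import all_boot all_order all_algebra.
From mathcomp Require Import all_classical all_reals all_analysis.

Set Implicit Arguments.
Unset Strict Implicit.
Unset Printing Implicit Defensive.

Import Order.TTheory GRing.Theory Num.Theory.

Local Open Scope ring_scope.

Definition edge (n : nat) : finType := {e : {set 'I_n} | #|e| == 2%N}.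

(* A graph on the labelled vertices 0, ..., n-1 is the set of its edges. *)
Definition graph (n : nat) : finType := {set edge n}.

Definition adj (n : nat) (G : graph n) : rel 'I_n :=
  fun x y => [exists e in G, val e == [set x; y]%SET].

Definition component (n : nat) (G : graph n) (v : 'I_n) : {set 'I_n} :=
  [set w | connect (adj G) v w]%SET.

Definition components (n : nat) (G : graph n) : {set {set 'I_n}} :=
  [set component G v | v in 'I_n]%SET.

Definition largest_component_size (n : nat) (G : graph n) : nat :=
  (\max_(C in components G) #|C|)%N.

(* The law of G(n,p): the product over all potential edges of the
   Bernoulli(p) law. The formula makes sense for every real p, and is a
   probability when 0 <= p <= 1. *)
Definition Gnp_weight (R : realType) (n : nat) (p : R) (G : graph n) : R :=
  \prod_(e : edge n) (if e \in G then p else 1 - p).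

Definition Gnp_prob (R : realType) (n : nat) (p : R) (B : pred (graph n)) : R :=
  \sum_(G : graph n | B G) Gnp_weight p G.

Lemma Gnp_probT (R : realType) (n : nat) (p : R) :
  Gnp_prob p (fun _ : graph n => true) = 1.
Proof.
transitivity (\prod_(e : edge n) (p + (1 - p))).
  by rewrite bigA_distr.
by apply: big1 => e _; rewrite addrC subrK.
Qed.

Lemma Gnp_prob_subset (R : realType) (n : nat) (p : R) (F : graph n) :
  Gnp_prob p (fun G : graph n => F \subset G) = p ^+ #|F|.
Proof.
transitivity (\prod_(e : edge n) (p + (if e \in F then 0 else 1 - p))).
  rewrite bigA_distr /Gnp_prob big_mkcond /=.
  apply: eq_bigr => G _; case: ifPn => [/fintype.subsetP FG|/fintype.subsetPn[e eF eG]].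
    apply: eq_bigr => e _; case: ifPn => // eG.
    by case: ifPn => // /FG; rewrite (negbTE eG).
  by rewrite (bigD1 e) //= (negbTE eG) eF mul0r.
rewrite (bigID (fun e => e \in F)) /= [X in _ * X]big1 ?mulr1.
  by rewrite -prodr_const; apply: eq_bigr => e ->; rewrite addr0.
by move=> e /negbTE ->; rewrite addrC subrK.
Qed.

Definition critical_p (R : realType) (lambda : R) (n : nat) : R :=
  (1 + lambda * n%:R `^ (- (1 / 3))) / n%:R.

Definition tail_exp (R : realType) (lambda A : R) : R :=
  expR (- (((A - 1) ^+ 2 / 2 - (A - 1) * lambda - 2) ^+ 2 / (4 * A))).

(* Main.v *)
Require Import Defs.
From mathcomp Require Import all_boot all_order all_algebra.
From mathcomp Require Import all_classical all_reals all_analysis.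
From mathcomp Require Import ring lra zify.

Set Implicit Arguments.
Unset Strict Implicit.
Unset Printing Implicit Defensive.

Import Order.TTheory GRing.Theory Num.Theory.

Local Open Scope ring_scope.

(** Why the theorem holds. Explore the component of [v] one vertex at a time:
    an active vertex is removed and its neighbours among the vertices not yet
    seen become active. The component has at least [k] vertices exactly when
    the exploration survives [k] steps, and the number of newly activated
    vertices is binomial with as many trials as there are unseen vertices.
    Conditioning on one edge at a time ([Gnp_expect_edge]) turns this into the
    exact identity [prob_component], where [survival] is a recursion on
    numbers. Every martingale argument then becomes an induction on that
    recursion with an explicit supersolution.

    Write [eps] for n^(-1/3), so that n p = 1 + lambda eps and n^(2/3) is
    eps^(-2). Split the A eps^(-2) steps into two phases.

    In the first eps^(-2) steps, the number of active vertices is dominated by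
    a random walk with steps Binomial(n, p) - 1, stopped when it is 0 or at
    least H, which is about 1/eps ([survival_escape]). It is not at 0 at the
    end only if it has reached H or if it has stayed strictly between 0 and H
    all the time. The first event is bounded by an affine function of an
    exponential, superharmonic for the walk, the second by Markov's inequality for the exit
    time ([escape_split], [stay_markov]). Both probabilities are of order eps,
    and give the constants in front of the exponential
    ([near_escape_supercritical], [near_escape_subcritical]).

    In the remaining (A - 1) eps^(-2) steps the depletion of the vertices
    matters: after j steps at most n - j of them are unseen, which creates the
    quadratic drift -(A - 1)^2/2. The Chernoff bound [survival_exp] with parameter
    a = x eps has a limiting exponent

      x + x lambda (A - 1) + x^2 (A - 1) - x (A - 1)^2/2 = - x (Q + 1) + x^2 (A - 1)

    with Q = (A - 1)^2/2 - (A - 1) lambda - 2. At x = Q/(2A) it equals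
    -Q^2/(4A) - x - x^2: the spare x + x^2 absorbs all the errors that vanish
    as n grows ([near_survival]).

    The bound for the largest component follows by Markov's inequality for the
    number of vertices whose component is large ([prob_largest_le]). *)

(** * Preliminaries *)

Lemma eq_ler (R : realType) (x y : R) : x = y -> x <= y.
Proof. by move->. Qed.

(** From exp(-a/2) >= 1 - a/2. The coefficient of a^2 matters: with 2 in place of 1,
    the exponent in [near_survival] would have no slack left when A is large. *)
Lemma expR_sub1_le (R : realType) (a : R) : 0 <= a <= 1 / 3 -> expR a - 1 <= a + a ^+ 2.
Proof.
move=> /andP[a0 a1].
have half : (1 - a / 2) ^+ 2 <= expR (- a).
  have -> : expR (- a) = expR (- (a / 2)) ^+ 2 by rewrite -expRM_natl; congr expR; field.
  by rewrite lerXn2r ?nnegrE ?expR_ge0 ?expR_ge1Dx //; lra.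
have expV : expR (- a) * expR a = 1 by rewrite -expRD addNr expR0.
have half' : (1 - a / 2) ^+ 2 * expR a <= 1.
  by rewrite -[leRHS]expV ler_wpM2r ?expR_ge0.
have pos : 0 < (1 - a / 2) ^+ 2 by apply: exprn_gt0; lra.
suff : (1 - a / 2) ^+ 2 * expR a <= (1 - a / 2) ^+ 2 * (1 + a + a ^+ 2).
  by rewrite ler_pM2l //; lra.
apply: le_trans half' _; rewrite -subr_ge0; set X := (X in 0 <= X).
have -> : X = a ^+ 2 * ((1 - 3 * a + a ^+ 2) / 4) by rewrite /X; field.
by rewrite mulr_ge0 ?sqr_ge0 // divr_ge0 //; have := sqr_ge0 a; lra.
Qed.

Lemma disjoint_setU1 (T : finType) (x : T) (A B : {set T}) :
  [disjoint (x |: A)%SET & B] = (x \notin B) && [disjoint A & B].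
Proof. by rewrite !finset.disjoints_subset finset.subUset finset.sub1set inE. Qed.

(** * Conditioning on one edge *)

Section Conditioning.
Variables (R : realType) (n : nat) (p : R).

Definition Gnp_expect (f : graph n -> R) : R :=
  \sum_(G : graph n) Gnp_weight p G * f G.

Lemma Gnp_probE (B : pred (graph n)) :
  Gnp_prob p B = Gnp_expect (fun G => (B G)%:R).
Proof.
rewrite /Gnp_prob big_mkcond; apply: eq_bigr => G _.
by case: (B G); rewrite ?mulr1 ?mulr0.
Qed.

Lemma eq_Gnp_expect (f g : graph n -> R) :
  f =1 g -> Gnp_expect f = Gnp_expect g.
Proof. by move=> fg; apply: eq_bigr => G _; rewrite fg. Qed.

Lemma Gnp_expect_const (c : R) : Gnp_expect (fun=> c) = c.
Proof.
rewrite /Gnp_expect -mulr_suml -[RHS]mul1r; congr (_ * _).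
by rewrite -(Gnp_probT n p) /Gnp_prob; apply: eq_bigl.
Qed.

(** The deferred-decision principle: the state of [e] is independent of the other
    edges, and neither of the functions on the right looks at [e]. *)
Lemma Gnp_expect_edge (e : edge n) (f : graph n -> R) :
  Gnp_expect f = p * Gnp_expect (fun G => f (e |: G)%SET)
               + (1 - p) * Gnp_expect (fun G => f (G :\ e)%SET).
Proof.
pose rest (G : graph n) : R := \prod_(e' | e' != e) (if e' \in G then p else 1 - p).
have weightE G : Gnp_weight p G = (if e \in G then p else 1 - p) * rest G.
  by rewrite /Gnp_weight (bigD1 e).
have restU G : rest (e |: G)%SET = rest G.
  by apply: eq_bigr => e' /negbTE ne; rewrite !inE ne.
have swap (h : graph n -> R) : (forall G, h (e |: G)%SET = h G) ->
    \sum_(G : graph n | e \notin G) rest G * h G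
    = \sum_(G : graph n | e \in G) rest G * h G.
  move=> hU; rewrite (reindex_onto (fun G => (G :\ e)%SET) (fun G => (e |: G)%SET)) /=.
    apply: eq_big => [G|G /andP[_ /eqP <-]].
      rewrite !inE eqxx /=; apply/eqP/idP => [<-|eG]; first by rewrite !inE eqxx.
      by rewrite finset.setD1K.
    rewrite finset.setU1K ?restU ?hU //.
    by rewrite !inE eqxx.
  by move=> G eG; rewrite finset.setU1K.
have split_e (h : graph n -> R) : (forall G, h (e |: G)%SET = h G) ->
    Gnp_expect h = \sum_(G : graph n | e \in G) rest G * h G.
  move=> hU; rewrite /Gnp_expect (bigID (fun G : graph n => e \in G)) /=.
  rewrite (eq_bigr (fun G => p * (rest G * h G))); last first.
    by move=> G eG; rewrite weightE eG mulrA.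
  rewrite [X in _ + X](eq_bigr (fun G => (1 - p) * (rest G * h G))); last first.
    by move=> G eG; rewrite weightE (negbTE eG) mulrA.
  by rewrite -!mulr_sumr swap // -mulrDl addrC subrK mul1r.
rewrite [in LHS]/Gnp_expect (bigID (fun G : graph n => e \in G)) /=.
rewrite (split_e (fun G => f (e |: G)%SET)); last first.
  by move=> G; rewrite finset.setUA finset.setUid.
have fD G : f ((e |: G) :\ e)%SET = f (G :\ e)%SET.
  by congr f; apply/setP => e'; rewrite !inE; case: (e' == e).
rewrite (split_e (fun G => f (G :\ e)%SET)) // -(swap (fun G => f (G :\ e)%SET)) //.
rewrite !mulr_sumr; congr (_ + _).
  apply: eq_bigr => G eG; rewrite weightE eG -mulrA; congr (_ * (_ * f _)).
  by apply/setP => e'; rewrite !inE; case: eqP => // ->.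
apply: eq_bigr => G eG; rewrite weightE (negbTE eG) -mulrA; congr (_ * (_ * f _)).
by apply/setP => e'; rewrite !inE; case: eqP => // ->; rewrite (negbTE eG).
Qed.

End Conditioning.

(** * Expectations of a binomial variable *)

Section Binomial.
Variable R : realType.

(** [binexp p m f] is the mean of [f] at a Binomial(m, p) variable. Tossing the
    coins one by one makes every moment and comparison below an induction on
    the number of coins. *)
Fixpoint binexp (p : R) (m : nat) (f : nat -> R) : R :=
  if m is m'.+1 then p * binexp p m' (fun j => f j.+1) + (1 - p) * binexp p m' f
  else f 0%N.

Lemma eq_binexp (p : R) (m : nat) (f g : nat -> R) : f =1 g -> binexp p m f = binexp p m g.
Proof.
elim: m f g => [|m IH] f g fg /=; first exact: fg.
by congr (_ * _ + _ * _); apply: IH => // j; apply: fg.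
Qed.

End Binomial.

Arguments eq_binexp {R p m f} g _.

Section BinomialMoments.
Variables (R : realType) (p : R).
Implicit Types (c : R) (f g : nat -> R).

Lemma binexpD m f g : binexp p m (fun j => f j + g j) = binexp p m f + binexp p m g.
Proof. by elim: m f g => [|m IH] f g //=; rewrite !IH; ring. Qed.

Lemma binexpZ m c f : binexp p m (fun j => c * f j) = c * binexp p m f.
Proof. by elim: m f => [|m IH] f //=; rewrite !IH; ring. Qed.

Lemma binexp_cst m c : binexp p m (fun=> c) = c.
Proof. by elim: m => [|m IH] //=; rewrite !IH; ring. Qed.

Lemma binexp_geom m c : binexp p m (fun j => c ^+ j) = (1 + p * (c - 1)) ^+ m.
Proof.
elim: m => [|m IH] //=.
under eq_binexp do rewrite exprS; rewrite binexpZ IH exprS; ring.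
Qed.

Lemma binexp_mean m : binexp p m (fun j => j%:R) = m%:R * p.
Proof.
elim: m => [|m IH] /=; first by rewrite mul0r.
rewrite (eq_binexp (fun j => j%:R + 1 : R)); last by move=> j; rewrite -natr1.
rewrite binexpD binexp_cst IH -[m.+1%:R]natr1; ring.
Qed.

Lemma binexp_sqr m :
  binexp p m (fun j => j%:R ^+ 2) = m%:R * p * (1 - p) + (m%:R * p) ^+ 2.
Proof.
elim: m => [|m IH] /=; first by ring.
rewrite (eq_binexp (fun j => (j%:R ^+ 2 + 2 * j%:R) + 1 : R)); last first.
  by move=> j; rewrite -natr1; ring.
rewrite !binexpD binexp_cst binexpZ binexp_mean IH -[m.+1%:R]natr1; ring.
Qed.

Hypothesis p01 : 0 <= p <= 1.
Let p_ge0 : 0 <= p. Proof. by case/andP: p01. Qed.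
Let q_ge0 : 0 <= 1 - p. Proof. by case/andP: p01 => _; rewrite subr_ge0. Qed.

Lemma binexp_le m f g : (forall j, f j <= g j) -> binexp p m f <= binexp p m g.
Proof.
elim: m f g => [|m IH] f g fg /=; first exact: fg.
by rewrite lerD // ler_wpM2l // IH.
Qed.

Lemma binexp_ge0 m f : (forall j, 0 <= f j) -> 0 <= binexp p m f.
Proof. by move=> f0; rewrite -[leLHS](binexp_cst m 0); apply: binexp_le. Qed.

Lemma binexp_leS m f : {homo f : i j / (i <= j)%N >-> i <= j} ->
  binexp p m f <= binexp p m.+1 f.
Proof.
move=> fm /=; have : binexp p m f <= binexp p m (fun j => f j.+1).
  by apply: binexp_le => j; apply: fm.
by move: p_ge0 q_ge0; set x := binexp _ _ _; set y := binexp _ _ _; nra.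
Qed.

Lemma binexp_leq m m' f : {homo f : i j / (i <= j)%N >-> i <= j} ->
  (m <= m')%N -> binexp p m f <= binexp p m' f.
Proof.
move=> fm /subnKC <-; elim: (m' - m)%N => [|d IH]; first by rewrite addn0.
by rewrite addnS; apply: le_trans IH (binexp_leS _ fm).
Qed.

(** Given that a binomial variable reaches [k], its excess over [k] is
    stochastically smaller than the variable itself: at the toss which brings
    the count to [k], at most [m] tosses remain. This controls the position of a
    walk at the moment when it jumps over a level. *)
Lemma binexp_overshoot m k f : {homo f : i j / (i <= j)%N >-> i <= j} ->
  (forall j, 0 <= f j) ->
  binexp p m (fun j => (k <= j)%N%:R * f (j - k)%N)
  <= binexp p m f * binexp p m (fun j => (k <= j)%N%:R).
Proof.
move=> fm f0; elim: m k => [|m IH] k.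
  by case: k => [|k] /=; rewrite ?mul0r ?mulr0 // mulrC.
case: k => [|k].
  rewrite [X in _ * X](eq_binexp (fun=> 1 : R)) // binexp_cst mulr1.
  by apply/eq_ler/eq_binexp => j; rewrite mul1r subn0.
rewrite [leLHS]/= [X in _ * X]/=.
set P1 := binexp p m (fun j => (k < j.+1)%N%:R).
set P2 := binexp p m (fun j => (k < j)%N%:R).
have P1_ge0 : 0 <= P1 by apply: binexp_ge0 => j.
have P2_ge0 : 0 <= P2 by apply: binexp_ge0 => j.
apply: (@le_trans _ _ (binexp p m f * (p * P1 + (1 - p) * P2))); last first.
  by rewrite ler_wpM2r ?binexp_leS // addr_ge0 ?mulr_ge0.
rewrite mulrDr !(mulrCA (binexp p m f)) lerD // ler_wpM2l //; exact: IH.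
Qed.

End BinomialMoments.

Arguments binexp_le {R p} p01 {m f} g _.

(** * Exploring a component *)

Section Reach.
Variable n : nat.
Implicit Types (G : graph n) (S U X D : {set 'I_n}) (s u : 'I_n).

(** The active vertices are [S] and the unseen ones are [U]. Only the steps into [U]
    are constrained, so that edges inside [S], which an exploration never
    inspects, have no influence. *)
Definition reach G S U : {set 'I_n} :=
  [set w | [exists v in S, connect (fun x y => adj G x y && (y \in U)) v w]]%SET.

Definition nbrs G s D : {set 'I_n} := [set u in D | adj G s u]%SET.

Lemma sub_reach G S U : S \subset reach G S U.
Proof.
by apply/fintype.subsetP => v vS; rewrite inE; apply/exists_inP; exists v.
Qed.

Lemma reach_step G S U x y :
  x \in reach G S U -> y \in U -> adj G x y -> y \in reach G S U.
Proof.
rewrite !inE => /exists_inP[v vS vx] yU xy; apply/exists_inP; exists v => //.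
by apply: connect_trans vx _; apply: connect1; rewrite xy yU.
Qed.

(** The induction principle of [reach]: it is the least set containing [S] and closed
    under edges into [U]. *)
Lemma reach_min G S U X : S \subset X ->
  (forall x y, x \in X -> y \in U -> adj G x y -> y \in X) ->
  reach G S U \subset X.
Proof.
move=> SX step; apply/fintype.subsetP => w; rewrite inE => /exists_inP[v vS].
move=> /connectP[q]; have := fintype.subsetP SX v vS.
elim: q v {vS} => [|y q IH] v vX /=; first by move=> _ ->.
by move=> /andP[/andP[vy yU] yq] wE; apply: (IH y) => //; apply: step vy.
Qed.

Lemma reach_sub G S U : reach G S U \subset (S :|: U)%SET.
Proof.
apply: reach_min; first exact: finset.subsetUl.
by move=> x y _ yU _; rewrite inE yU orbT.
Qed.

Lemma reach_local G G' S U :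
  (forall x y, x \in (S :|: U)%SET -> y \in U -> adj G x y = adj G' x y) ->
  reach G S U = reach G' S U.
Proof.
have half G1 G2 :
    (forall x y, x \in (S :|: U)%SET -> y \in U -> adj G1 x y = adj G2 x y) ->
    reach G1 S U \subset reach G2 S U.
  move=> E; apply: reach_min; first exact: sub_reach.
  move=> x y xR yU xy; apply: (reach_step xR) => //.
  by rewrite -E //; apply: fintype.subsetP xR; apply: reach_sub.
move=> E; apply/eqP; rewrite finset.eqEsubset !half // => x y xS yU.
by rewrite E.
Qed.

(** One step of the exploration: [s] is removed, its unseen neighbours become active.
    The right-hand side never uses an edge at [s] again except through [nbrs G s U],
    which is what makes the steps independent. *)
Lemma reach_explore G s S U :
  reach G (s |: S) U
  = (s |: reach G (S :|: nbrs G s U) (U :\: nbrs G s U))%SET.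
Proof.
apply/eqP; rewrite finset.eqEsubset; apply/andP; split.
  apply: reach_min.
    apply: finset.setUS; apply: fintype.subset_trans (sub_reach _ _ _).
    exact: finset.subsetUl.
  move=> x y; rewrite !in_setU1 => /predU1P[->|xR] yU xy.
    apply/orP; right; apply: (fintype.subsetP (sub_reach _ _ _)).
    by rewrite !inE yU xy orbT.
  apply/orP; right; have [yN|yN] := boolP (y \in nbrs G s U).
    by apply: (fintype.subsetP (sub_reach _ _ _)); rewrite inE yN orbT.
  by apply: reach_step xR _ xy; rewrite inE yN.
have sR : s \in reach G (s |: S) U.
  by apply: (fintype.subsetP (sub_reach _ _ _)); rewrite !inE eqxx.
rewrite finset.subUset finset.sub1set sR /=; apply: reach_min.
  rewrite finset.subUset; apply/andP; split.
    apply: fintype.subset_trans (sub_reach _ _ _); exact: finset.subsetUr.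
  by apply/fintype.subsetP => u; rewrite inE => /andP[uU su]; apply: reach_step sR uU su.
by move=> x y xR; rewrite inE => /andP[_ yU]; apply: reach_step.
Qed.

Lemma component_reach G v : component G v = reach G [set v]%SET (~: [set v])%SET.
Proof.
apply/eqP; rewrite finset.eqEsubset; apply/andP; split.
  have vR : v \in reach G [set v]%SET (~: [set v])%SET.
    by apply: (fintype.subsetP (sub_reach _ _ _)); rewrite inE.
  apply/fintype.subsetP => w; rewrite inE => /connectP[q].
  elim: q {1 4 5}v vR => [|y q IH] x xR /=.
    by move=> _ ->.
  move=> /andP[xy yq] wE; apply: (IH y) => //; have [yv|yv] := eqVneq y v.
    by rewrite yv; apply: (fintype.subsetP (sub_reach _ _ _)); rewrite inE.
  by apply: reach_step xR _ xy; rewrite !inE.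
apply: reach_min; first by rewrite finset.sub1set inE connect0.
by move=> x y; rewrite !inE => vx _ xy; apply: connect_trans vx (connect1 xy).
Qed.

Lemma adj_addE (e : edge n) G x y :
  adj (e |: G)%SET x y = (val e == [set x; y]%SET) || adj G x y.
Proof.
apply/exists_inP/orP => [[e']|[|]].
- by rewrite !inE => /predU1P[->|e'G] exy; [left|right; apply/exists_inP; exists e'].
- by exists e => //; rewrite !inE eqxx.
- by move=> /exists_inP[e' e'G exy]; exists e' => //; rewrite !inE e'G orbT.
Qed.

Lemma adj_delE (e : edge n) G x y :
  adj (G :\ e)%SET x y = (val e != [set x; y]%SET) && adj G x y.
Proof.
apply/exists_inP/andP => [[e']|[ne /exists_inP[e' e'G exy]]].
  rewrite !inE => /andP[ne e'G] exy; split; last by apply/exists_inP; exists e'.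
  by apply: contra ne => /eqP exy'; apply/eqP/val_inj; rewrite exy' (eqP exy).
exists e' => //; rewrite !inE e'G andbT; apply: contra ne => /eqP <-; exact: exy.
Qed.

Lemma edge_of (s u : 'I_n) : s != u -> exists e : edge n, val e = [set s; u]%SET.
Proof.
move=> su; have c2 : #|[set s; u]%SET| == 2%N by rewrite cards2 su.
by exists (Sub [set s; u]%SET c2).
Qed.

Lemma set2_eq_mem (s u x y : 'I_n) :
  [set s; u]%SET == [set x; y]%SET -> (s == x) || (s == y).
Proof. by move=> /eqP E; have := set21 s u; rewrite E !inE. Qed.

Lemma set2_eqr (s u v : 'I_n) : ([set s; u]%SET == [set s; v]%SET) = (u == v).
Proof.
apply/eqP/eqP => [E|-> //].
have := set22 s u; rewrite E !inE => /orP[/eqP us|/eqP //].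
by have := set22 s v; rewrite -E us !inE orbb => /eqP.
Qed.

Lemma reach_addE (e : edge n) G s u S U : val e = [set s; u]%SET ->
  s \notin S -> s \notin U -> reach (e |: G)%SET S U = reach G S U.
Proof.
move=> eE sS sU; apply: reach_local => x y xSU yU.
rewrite adj_addE eE; case: eqP => //= /eqP /set2_eq_mem /orP[] /eqP sx.
  by move: xSU; rewrite -sx inE (negbTE sS) (negbTE sU).
by move: sU; rewrite sx yU.
Qed.

Lemma reach_delE (e : edge n) G s u S U : val e = [set s; u]%SET ->
  s \notin S -> s \notin U -> reach (G :\ e)%SET S U = reach G S U.
Proof.
move=> eE sS sU; apply: reach_local => x y xSU yU.
rewrite adj_delE eE; case: eqP => //= /eqP /set2_eq_mem /orP[] /eqP sx.
  by move: xSU; rewrite -sx inE (negbTE sS) (negbTE sU).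
by move: sU; rewrite sx yU.
Qed.

End Reach.

Section Exploration.
Variables (R : realType) (n : nat) (p : R).

(** The probability that the exploration performs at least [k] steps, when [N]
    vertices are unexplored and [y] of them are active: a step removes one
    active vertex and activates a binomial number of the [N - y] others. *)
Fixpoint survival (k N y : nat) : R :=
  match k, N, y with
  | 0%N, _, _ => 1
  | k'.+1, N'.+1, y'.+1 => binexp p (N' - y') (fun j => survival k' N' (y' + j))
  | _, _, _ => 0
  end.

(** The edges between [s] and [D] are revealed one by one. Once an edge at [s] has
    been revealed, [reach] no longer depends on it, because [s] belongs to neither
    set; the two cases are the two branches of [binexp]. *)
Lemma reveal_nbrs (k : nat) (s : 'I_n) (D S U : {set 'I_n}) :
  (forall S U : {set 'I_n}, [disjoint S & U] ->
    Gnp_expect p (fun G => (k <= #|reach G S U|)%N%:R)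
    = survival k (#|S| + #|U|) #|S|) ->
  [disjoint (s |: S)%SET & U] -> s \notin S -> D \subset U ->
  Gnp_expect p (fun G =>
    (k <= #|reach G (S :|: nbrs G s D)%SET (U :\: nbrs G s D)%SET|)%N%:R)
  = binexp p #|D| (fun j => survival k (#|S| + #|U|) (#|S| + j)).
Proof.
move=> IHk.
have [d] := ubnP #|D|; elim: d D S U => // d IHd D S U.
have [->|[u uD]] := set_0Vmem D.
  move=> _ dSU sS _; rewrite cards0 /= addn0 -IHk; last first.
    by apply: disjointWl dSU; apply: finset.subsetUr.
  apply: eq_Gnp_expect => G.
  have -> : nbrs G s finset.set0 = finset.set0 by apply/setP => x; rewrite !inE.
  by rewrite finset.setU0 finset.setD0.
rewrite (cardsD1 u D) uD add1n ltnS => Dd dSU sS DU.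
have uU := fintype.subsetP DU u uD.
have sU : s \notin U by move: dSU; rewrite disjoint_setU1 => /andP[].
have su : s != u by apply: contraNneq sU => ->.
have uS : u \notin S.
  by apply: contraTN uU => uS; rewrite (disjointFr dSU) // !inE uS orbT.
have [e eE] := edge_of su.
rewrite (Gnp_expect_edge p e) /=.
have sN G (D' : {set 'I_n}) : D' \subset U -> s \notin nbrs G s D'.
  move=> D'U; apply: contra sU; rewrite inE => /andP[sD' _].
  exact: fintype.subsetP sD'.
have nbrsU G : nbrs (e |: G)%SET s D = (u |: nbrs G s (D :\ u))%SET.
  apply/setP => x; rewrite !inE adj_addE eE set2_eqr eq_sym.
  by have [->|xu] := eqVneq x u; rewrite ?uD //= andbT.
have nbrsD G : nbrs (G :\ e)%SET s D = nbrs G s (D :\ u)%SET.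
  apply/setP => x; rewrite !inE adj_delE eE set2_eqr eq_sym.
  by have [->|xu] := eqVneq x u; rewrite ?andbF //= andbT.
have DuU : (D :\ u \subset U)%SET.
  by apply: fintype.subset_trans DU; apply: finset.subD1set.
congr (_ * _ + _ * _).
  rewrite (@eq_Gnp_expect _ _ _ _ (fun G => (k <= #|reach G
       ((u |: S) :|: nbrs G s (D :\ u)) ((U :\ u) :\: nbrs G s (D :\ u))|)%N%:R)).
    rewrite (IHd (D :\ u)%SET (u |: S)%SET (U :\ u)%SET) ?finset.setSD //.
    - rewrite cardsU1 uS (cardsD1 u U) uU /=; apply: eq_binexp => j.
      by congr survival; lia.
    - rewrite !disjoint_setU1 !inE eqxx /= (negbTE sU) andbF /=.
      by move: dSU; rewrite disjoint_setU1 => /andP[_]; apply: disjointWr; apply: finset.subD1set.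
    - by rewrite !inE negb_or su.
  move=> G; rewrite nbrsU.
  have -> : (S :|: (u |: nbrs G s (D :\ u)) = (u |: S) :|: nbrs G s (D :\ u))%SET.
    by apply/setP => x; rewrite !inE; do !case: (_ == _); do !case: (_ \in _).
  have -> : (U :\: (u |: nbrs G s (D :\ u)) = (U :\ u) :\: nbrs G s (D :\ u))%SET.
    by rewrite finset.setDDl.
  rewrite (reach_addE _ eE) //.
    by rewrite !finset.in_setU finset.in_set1 (negbTE su) (negbTE sS) (negbTE (sN _ _ DuU)).
  by rewrite !finset.in_setD (negbTE sU) !andbF.
rewrite -(IHd (D :\ u)%SET S U Dd dSU sS DuU).
apply: eq_Gnp_expect => G; rewrite nbrsD (reach_delE _ eE) //; first by rewrite finset.in_setU negb_or sS sN.
by rewrite finset.in_setD (negbTE sU) andbF.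
Qed.

Lemma prob_reach (k : nat) (S U : {set 'I_n}) : [disjoint S & U] ->
  Gnp_expect p (fun G => (k <= #|reach G S U|)%N%:R)
  = survival k (#|S| + #|U|) #|S|.
Proof.
elim: k S U => [|k IH] S U dSU.
  by rewrite -[RHS](Gnp_expect_const n p); apply: eq_Gnp_expect => G; rewrite leq0n.
have [->|[s sS]] := set_0Vmem S.
  rewrite cards0 /=; transitivity (0 : R); last by case: (0 + #|U|)%N.
  rewrite -(Gnp_expect_const n p 0); apply: eq_Gnp_expect => G.
  have -> : reach G finset.set0 U = finset.set0.
    by apply/eqP; rewrite -finset.subset0; apply: reach_min; rewrite ?finset.sub0set // => x y; rewrite inE.
  by rewrite cards0.
rewrite -(finset.setD1K sS) in dSU *; set S' := (S :\ s)%SET in dSU *.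
have sS' : s \notin S' by rewrite !inE eqxx.
have sU : s \notin U by move: dSU; rewrite disjoint_setU1 => /andP[].
rewrite cardsU1 sS' add1n addSn [RHS]/= addKn -(reveal_nbrs (s := s)) //.
apply: eq_Gnp_expect => G; rewrite reach_explore cardsU1.
suff -> : s \notin reach G (S' :|: nbrs G s U) (U :\: nbrs G s U) by rewrite add1n ltnS.
apply/negP => /(fintype.subsetP (reach_sub _ _ _)).
by rewrite !finset.in_setU (negbTE sS') finset.in_setD (negbTE sU) andbF orbF inE (negbTE sU).
Qed.

Lemma prob_component (k : nat) (v : 'I_n) :
  Gnp_expect p (fun G => (k <= #|component G v|)%N%:R) = survival k n 1.
Proof.
under eq_Gnp_expect do rewrite component_reach.
rewrite prob_reach; last by rewrite -setI_eq0 finset.setICr.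
by rewrite finset.cardsC card_ord cards1.
Qed.

End Exploration.

(** * Chernoff bound for the exploration *)

Section Survival.
Variables (R : realType) (p : R).
Hypothesis p01 : 0 <= p <= 1.
Let p_ge0 : 0 <= p. Proof. by case/andP: p01. Qed.

Lemma survival_decr k N y : survival p k.+1 N y <= survival p k N y.
Proof.
elim: k N y => [|k IH] [|N] [|y] //.
  by rewrite /= binexp_cst.
by apply: binexp_le => // j; apply: IH.
Qed.

Lemma survival_anti k k' N y : (k <= k')%N -> survival p k' N y <= survival p k N y.
Proof.
move=> /subnKC <-; elim: (k' - k)%N => [|d IH]; first by rewrite addn0.
by rewrite addnS; apply: le_trans (survival_decr _ _ _) IH.
Qed.

Lemma binexp_expR (a : R) m :
  binexp p m (fun j => expR (a * j%:R)) <= expR (m%:R * (p * (expR a - 1))).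
Proof.
rewrite (eq_binexp (fun j => expR a ^+ j)); last first.
  by move=> j; rewrite -expRM_natl mulrC.
rewrite binexp_geom expRM_natl lerXn2r ?nnegrE ?expR_ge0 //; last exact: expR_ge1Dx.
have := expR_ge0 a; move: p01 => /andP[]; nra.
Qed.

(** Each step multiplies the mean of exp(a y) by at most
    exp(N p (e^a - 1) - a), where [N] is the number of vertices left; since [N]
    decreases at every step, the exponents sum to a concave quadratic in [k]. *)
Lemma survival_exp (a : R) k N y : 0 <= a ->
  survival p k N y <=
  expR (a * y%:R + k%:R * (N%:R * (p * (expR a - 1)) - a)
        - p * (expR a - 1) * (k%:R * (k%:R - 1) / 2)).
Proof.
move=> a0; set c := p * (expR a - 1).
have c0 : 0 <= c by rewrite mulr_ge0 // subr_ge0 -expR0 ler_expR.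
elim: k N y => [|k IH] N y.
  by rewrite !mul0r mulr0 subr0 addr0 -[leLHS]expR0 ler_expR mulr_ge0.
case: N y => [|N] [|y]; rewrite ?expR_ge0 //.
rewrite [leLHS]/=.
set B := k%:R * (N%:R * c - a) - c * (k%:R * (k%:R - 1) / 2).
apply: le_trans (binexp_le p01 (fun j => expR (a * y%:R + B) * expR (a * j%:R)) _) _.
  move=> j; apply: le_trans (IH _ _) _; rewrite -expRD ler_expR natrD /B; lra.
rewrite binexpZ; apply: le_trans (ler_wpM2l (expR_ge0 _) (binexp_expR _ _)) _.
rewrite -expRD ler_expR -/c /B.
have Ny : (N - y)%:R * c <= N%:R * c by rewrite ler_wpM2r // ler_nat leq_subr.
apply: le_trans (lerD (lexx _) Ny) _.
rewrite -[k.+1%:R]natr1 -[N.+1%:R]natr1 -[y.+1%:R]natr1.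
rewrite -subr_ge0; set X := (X in 0 <= X).
suff -> : X = c by [].
by rewrite /X; field.
Qed.

End Survival.

(** * Comparison with a stopped random walk *)

Section Walk.
Variables (R : realType) (p : R) (n H : nat).
Hypothesis p01 : 0 <= p <= 1.
Let p_ge0 : 0 <= p. Proof. by case/andP: p01. Qed.

(** The walk with steps Binomial(n, p) - 1, started at [y] and stopped when it is 0 or
    at least [H]: the probability that it is not at 0 after [r] steps. *)
Fixpoint escape (r y : nat) : R :=
  if (y == 0)%N then 0 else if (H <= y)%N then 1 else
  if r is r'.+1 then binexp p n (fun j => escape r' (y.-1 + j)) else 1.

(** The probability that the same walk is still strictly between 0 and [H]. *)
Fixpoint stay (r y : nat) : R :=
  if (0 < y < H)%N then
    if r is r'.+1 then binexp p n (fun j => stay r' (y.-1 + j)) else 1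
  else 0.

Lemma stay_ge0 r y : 0 <= stay r y.
Proof. by elim: r y => [|r IH] y /=; case: ifP => // _; apply: binexp_ge0. Qed.

Lemma escape01 r y : 0 <= escape r y <= 1.
Proof.
elim: r y => [|r IH] y /=; case: ifP => _; rewrite ?lexx ?ler01 //;
  case: ifP => _; rewrite ?lexx ?ler01 //.
apply/andP; split; first by apply: binexp_ge0 => // j; case/andP: (IH (y.-1 + j)%N).
rewrite -[leRHS](binexp_cst p n 1); apply: binexp_le => // j.
by case/andP: (IH (y.-1 + j)%N).
Qed.

(** Monotonicity in the starting point is what allows replacing the shrinking number
    of unseen vertices by [n], whatever the sign of the drift. *)
Lemma escape_homo r : {homo escape r : y z / (y <= z)%N >-> y <= z}.
Proof.
have [e0 e1] : (forall r y, 0 <= escape r y) /\ (forall r y, escape r y <= 1).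
  by split=> r' y; case/andP: (escape01 r' y).
elim: r => [|r IH] y z yz.
  rewrite /=; case: (posnP y) => [|y0]; first by move=> _; do !case: ifP.
  have z0 : (0 < z)%N by apply: leq_trans yz.
  by rewrite (gtn_eqF z0); do !case: ifP.
have [Hz|zH] := leqP H z.
  case: (posnP z) => [z0|z0]; last by rewrite [leRHS]/= gtn_eqF // Hz.
  by move: yz; rewrite z0 leqn0 => /eqP ->.
case: (posnP y) => [->|y0]; first exact: e0.
have z0 : (0 < z)%N by apply: leq_trans yz.
rewrite /= (gtn_eqF y0) (gtn_eqF z0) (leqNgt H z) zH (leqNgt H y) (leq_ltn_trans yz zH) /=.
by apply: binexp_le => // j; apply: IH; lia.
Qed.

Lemma escape_step r y : (0 < y < H)%N ->
  escape r.+1 y = binexp p n (fun j => escape r (y.-1 + j)).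
Proof. by move=> /andP[y0 yH] /=; rewrite gtn_eqF // leqNgt yH. Qed.

Lemma escape_above r y : (0 < H <= y)%N -> escape r y = 1.
Proof.
by move=> /andP[H0 Hy]; case: r => [|r] /=; rewrite gtn_eqF ?(leq_trans H0) // Hy.
Qed.

(** The exploration runs [r] steps against the walk and then [K'] steps against the
    bound assumed on [survival p K']. When the walk is stopped above [H], the
    bound is applied at the overshoot position, which costs the factor
    exp(n p (e^a - 1)) by [binexp_overshoot]; the steps saved by stopping early
    are discarded, as surviving longer is less likely. *)
Lemma survival_escape (a C : R) (K' r N y : nat) :
  0 <= a -> 0 <= C -> (0 < K')%N -> (N <= n)%N -> (y < H)%N ->
  (forall N' y', (N' <= n)%N -> survival p K' N' y' <= C * expR (a * y'%:R)) ->
  survival p (r + K') N y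
  <= expR (n%:R * (p * (expR a - 1))) * (C * expR (a * H%:R)) * escape r y.
Proof.
move=> a0 C0 K0 + + HK; set M := expR (n%:R * _); set D := C * expR _.
have M1 : 1 <= M.
  by rewrite -expR0 ler_expR !mulr_ge0 // subr_ge0 -expR0 ler_expR.
have D0 : 0 <= D by rewrite mulr_ge0 ?expR_ge0.
have H_gt0 y' : (y' < H)%N -> (0 < H)%N by apply: leq_ltn_trans.
elim: r N y => [|r IH] N y Nn yH.
  case: y yH => [|y] yH; first by rewrite /= mulr0; case: K' K0 {HK} N {Nn} => // K' _ [].
  rewrite /= leqNgt yH mulr1 /= add0n.
  apply: le_trans (HK _ _ Nn) _; apply: (@le_trans _ _ D); last by rewrite ler_peMl.
  by rewrite ler_wpM2l // ler_expR ler_wpM2l // ler_nat ltnW.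
case: N Nn => [|N] Nn; first by rewrite /= !mulr_ge0 // ?expR_ge0 //; case/andP: (escape01 r.+1 y).
case: y yH => [|y] yH; first by rewrite /= mulr0.
rewrite escape_step ?yH // addSn [leLHS]/= [y.+1.-1]/=.
set k := (H - y)%N.
have below j : survival p (r + K') N (y + j)
    <= M * D * (escape r (y + j) * (j < k)%N%:R)
       + D * ((k <= j)%N%:R * expR (a * (j - k)%N%:R)).
  have [kj|jk] := leqP k j.
    rewrite mulr0 mulr0 add0r mul1r.
    apply: le_trans (survival_anti p01 _ _ (leq_addl r K')) _.
    apply: le_trans (HK _ _ (ltnW Nn)) _.
    rewrite /D -mulrA -expRD -mulrDr -natrD ler_wpM2l // ler_expR ler_wpM2l //.
    by rewrite ler_nat /k; lia.
  rewrite mulr1 mul0r mulr0 addr0; apply: IH; first exact: ltnW.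
  by rewrite /k in jk; lia.
apply: le_trans (binexp_le p01 _ below) _.
rewrite binexpD !binexpZ.
apply: (@le_trans _ _ (M * D * binexp p (N - y) (fun j => escape r (y + j) * (j < k)%N%:R)
    + D * (M * binexp p (N - y) (fun j => (k <= j)%N%:R)))).
  rewrite lerD2l ler_wpM2l //.
  have overshoot := @binexp_overshoot _ _ p01 (N - y) k (fun j => expR (a * j%:R)).
  apply: le_trans (overshoot _ _) _.
  - by move=> i j ij; rewrite ler_expR ler_wpM2l // ler_nat.
  - by move=> j; apply: expR_ge0.
  rewrite ler_wpM2r ?binexp_ge0 //.
  apply: le_trans (binexp_expR p01 _ _) _; rewrite ler_expR ler_wpM2r //.
    by rewrite mulr_ge0 // subr_ge0 -expR0 ler_expR.
  by rewrite ler_nat; lia.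
rewrite (mulrCA D) mulrA -mulrDr ler_wpM2l ?mulr_ge0 ?(le_trans ler01 M1) //.
rewrite -binexpD; apply: (@le_trans _ _ (binexp p (N - y) (fun j => escape r (y + j)))).
  apply: binexp_le => // j; have [kj|jk] := leqP k j; last by rewrite mulr1 addr0.
  by rewrite mulr0 add0r escape_above // (H_gt0 _ yH) /=; rewrite /k in kj; lia.
apply: binexp_leq => //; last by lia.
by move=> i j ij; apply: escape_homo; rewrite leq_add2l.
Qed.

(** Optional stopping: a nonnegative superharmonic function which is at least 1 above
    [H] dominates the probability of exceeding [H] before 0. *)
Lemma escape_split (alpha : nat -> R) r y : (0 < H)%N ->
  (forall y, 0 <= alpha y) -> (forall y, (H <= y)%N -> 1 <= alpha y) ->
  (forall y, (0 < y < H)%N -> binexp p n (fun j => alpha (y.-1 + j)%N) <= alpha y) ->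
  escape r y <= alpha y + stay r y.
Proof.
move=> H0 a0 a1 aS.
elim: r y => [|r IH] y.
  rewrite /=; case: (posnP y) => [->|y0] /=; first by rewrite addr0.
  rewrite ltnNge; case: leqP => Hy /=; first by rewrite addr0 a1.
  by rewrite lerDr.
have [yy|] := boolP (0 < y < H)%N.
  rewrite escape_step // [stay _ _]/= yy; apply: le_trans (binexp_le p01 _ (fun j => IH _)) _.
  by rewrite binexpD lerD2r aS.
rewrite negb_and -eqn0Ngt -leqNgt => /orP[/eqP ->|Hy]; first by rewrite /= addr0.
by rewrite escape_above ?H0 // (le_trans (a1 _ Hy)) // lerDl stay_ge0.
Qed.

(** Markov's inequality for the exit time: the sum of [stay r y] over [r] is the mean
    exit time, and [e] is a supersolution of the equation that it satisfies. *)
Lemma stay_markov (e : nat -> R) (T y : nat) :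
  (forall y, (y < H)%N -> 0 <= e y) ->
  (forall y, (0 < y < H)%N ->
     1 + binexp p n (fun j => e (y.-1 + j)%N * (y.-1 + j < H)%N%:R) <= e y) ->
  (0 < y < H)%N -> T%:R * stay T y <= e y.
Proof.
move=> e0 eS yH.
have stayE r' y' : stay r'.+1 y' =
  if (0 < y' < H)%N then binexp p n (fun j => stay r' (y'.-1 + j)) else 0 by [].
have decr r' y' : stay r'.+1 y' <= stay r' y'.
  elim: r' y' => [|r' IH] y'.
    rewrite /=; case: ifP => // _; rewrite -[leRHS](binexp_cst p n 1).
    by apply: binexp_le => // j; case: ifP.
  rewrite stayE [leRHS]stayE; case: ifP => // _.
  by apply: binexp_le => // j; apply: IH.
have sum_le t y' : (y' < H)%N -> \sum_(r < t) stay r y' <= e y'.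
  elim: t y' => [|t IH] y' y'H; first by rewrite big_ord0 e0.
  have [yy|] := boolP (0 < y' < H)%N; last first.
    rewrite y'H andbT -eqn0Ngt => /eqP y'0.
    by rewrite big1 ?e0 // => -[[|r] ?] _; rewrite y'0.
  rewrite big_ord_recl /= yy; apply: le_trans (eS _ yy).
  rewrite lerD2l.
  have -> : \sum_(i < t) binexp p n (fun j => stay i (y'.-1 + j))
      = binexp p n (fun j => \sum_(i < t) stay i (y'.-1 + j)).
    elim: {IH} t => [|t IHt]; first by rewrite big_ord0 (eq_binexp (fun=> 0)) ?binexp_cst // => j; rewrite big_ord0.
    rewrite big_ord_recr /= IHt -binexpD; apply: eq_binexp => j.
    by rewrite big_ord_recr.
  apply: binexp_le => // j; have [Hz|zH] := ltnP; first by rewrite mulr1 IH.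
  rewrite mulr0 big1 // => i _; case: (val i) => [|r] /=; by rewrite [(_ < H)%N]ltnNge zH andbF.
apply: le_trans (sum_le T y _); last by case/andP: yH.
rewrite -[T in T%:R]card_ord -sumr_const mulr_suml ler_sum // => i _.
rewrite mul1r; move: (val i) (ltnW (ltn_ord i)) => r /= /subnKC <-.
elim: (T - r)%N => [|d IH]; first by rewrite addn0.
by rewrite addnS; apply: le_trans (decr _ _) IH.
Qed.

End Walk.

(** * Gambler's ruin near zero drift *)

Section Ruin.
Variables (R : realType) (p : R) (n H : nat).
Hypothesis p01 : 0 <= p <= 1.
Let p_ge0 : 0 <= p. Proof. by case/andP: p01. Qed.
Hypothesis H_gt1 : (1 < H)%N.

Lemma natr_pred_add y j : (0 < y)%N -> (y.-1 + j)%:R = y%:R - 1 + j%:R :> R.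
Proof. by case: y => // y _; rewrite natrD -[y.+1%:R]natr1 addrK. Qed.

Section Subcritical.
Variable theta : R.
Hypothesis theta_gt0 : 0 < theta.
Hypothesis drift : n%:R * p = 1 - theta.

(** exp(theta y) is superharmonic: (1 - theta)(e^theta - 1) <= theta amounts to
    1 - theta <= e^(-theta). *)
Lemma escape_subcritical r :
  escape p n H r 1 <= (expR theta - 1) / (expR (theta * H%:R) - 1) + stay p n H r 1.
Proof.
pose d := expR (theta * H%:R) - 1.
have H0 : (0 < H)%N by apply: ltnW.
have d0 : 0 < d by rewrite subr_gt0 expR_gt1 mulr_gt0 ?ltr0n.
pose alpha (y : nat) := (expR (theta * y%:R) - 1) / d.
have -> : (expR theta - 1) / (expR (theta * H%:R) - 1) = alpha 1%N.
  by rewrite /alpha mulr1.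
apply: (@escape_split _ p n H p01 alpha) => //.
- by move=> y; rewrite divr_ge0 ?(ltW d0) // subr_ge0 -[leLHS]expR0 ler_expR mulr_ge0 // ltW.
- move=> y Hy; rewrite ler_pdivlMr // mul1r /d lerD2r ler_expR ler_pM2l //.
  by rewrite ler_nat.
- move=> y /andP[y0 yH].
  rewrite (eq_binexp (fun j => d^-1 * (expR (theta * (y%:R - 1)) * expR (theta * j%:R) + (-1)))); last first.
    by move=> j; rewrite /alpha natr_pred_add // mulrDr expRD mulrC.
  rewrite binexpZ binexpD binexp_cst binexpZ /alpha mulrC ler_pM2r ?invr_gt0 //.
  rewrite lerD2r; apply: le_trans (ler_wpM2l (expR_ge0 _) (binexp_expR p01 _ _)) _.
  rewrite -expRD ler_expR mulrA drift.
  have : (1 - theta) * expR theta <= 1.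
    rewrite -[leRHS](mulVf (lt0r_neq0 (expR_gt0 theta))) ler_pM2r ?expR_gt0 //.
    by rewrite -expRN expR_ge1Dx.
  by lra.
Qed.

(** Wald's identity: a walk with drift -theta started at 1 hits 0 after 1/theta steps
    on average. *)
Lemma stay_subcritical T : T%:R * stay p n H T 1 <= theta^-1.
Proof.
have -> : theta^-1 = (fun y : nat => theta^-1 * y%:R) 1%N by rewrite /= mulr1.
apply: (stay_markov p01 (e := fun y => theta^-1 * y%:R)); last by rewrite H_gt1.
  by move=> y _; rewrite mulr_ge0 // invr_ge0 ltW.
move=> y /andP[y0 yH].
have le1 j : theta^-1 * (y.-1 + j)%:R * (y.-1 + j < H)%N%:R
    <= theta^-1 * ((y%:R - 1) + j%:R).
  rewrite -natr_pred_add // ler_piMr //; first by rewrite mulr_ge0 // invr_ge0 ltW.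
  by case: ltnP.
rewrite -lerBrDl; apply: le_trans (binexp_le p01 _ le1) _.
rewrite binexpZ binexpD binexp_cst binexp_mean drift.
apply: eq_ler; field; exact: lt0r_neq0.
Qed.

(** A bound that does not blow up when theta tends to 0. The function
    e(y) = 2 (2 H y - y^2) has a second difference of -4, so the variance, which
    is at least 1/2, makes it decrease by at least 1 per step; the negative drift
    helps because e increases on [0, H]. *)
Lemma stay_near_critical T : 1 / 2 <= n%:R * p * (1 - p) ->
  T%:R * stay p n H T 1 <= 4 * H%:R.
Proof.
move=> var.
pose e (y : nat) : R := 2 * (H%:R ^+ 2 - (H%:R - y%:R) ^+ 2).
have hH : 2 <= H%:R :> R by rewrite ler_nat.
apply: (@le_trans _ _ (e 1%N)); last by rewrite /e; nra.
apply: (stay_markov p01 (e := e)); last by rewrite H_gt1.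
  move=> y yH; have : y%:R <= H%:R :> R by rewrite ler_nat ltnW.
  by have : 0 <= y%:R :> R by []; rewrite /e; nra.
move=> y /andP[y0 yH]; set k := (H - y.-1)%N.
have above j : e (y.-1 + j)%N * (y.-1 + j < H)%N%:R
    <= (2 * (H%:R ^+ 2 - (H%:R - (y%:R - 1)) ^+ 2) + 4 * (H%:R - (y%:R - 1)) * j%:R
        + (-2) * j%:R ^+ 2)
       + (2 * ((k <= j)%N%:R * (j - k)%N%:R ^+ 2) + (-2 * H%:R ^+ 2) * (k <= j)%N%:R).
  (* Above H the value of e is 2 (H^2 - (z - H)^2), a function of the overshoot. *)
  rewrite /e natr_pred_add //.
  have [kj|jk] := leqP k j; last first.
    rewrite (_ : (_ < H)%N); last by rewrite /k in jk; lia.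
    by apply: eq_ler; rewrite /=; ring.
  rewrite (_ : (_ < H)%N = false); last by rewrite /k in kj; lia.
  have -> : (j - k)%N%:R = y%:R - 1 + j%:R - H%:R :> R.
    rewrite -natr_pred_add // -natrB; last by rewrite /k in kj; lia.
    by congr (_%:R); rewrite /k in kj *; lia.
  by apply: eq_ler; rewrite /=; ring.
rewrite -lerBrDl; apply: le_trans (binexp_le p01 _ above) _.
rewrite !binexpD !binexpZ binexp_cst binexp_mean binexp_sqr.
have ov : binexp p n (fun j => (k <= j)%N%:R * (j - k)%N%:R ^+ 2)
    <= binexp p n (fun j => j%:R ^+ 2) * binexp p n (fun j => (k <= j)%N%:R).
  apply: (@binexp_overshoot _ _ p01 n k (fun j => j%:R ^+ 2)) => [i j ij|j].
    by rewrite lerXn2r ?nnegrE // ler_nat.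
  exact: sqr_ge0.
move: ov; rewrite binexp_sqr drift.
have : 0 <= binexp p n (fun j => (k <= j)%N%:R) by apply: binexp_ge0.
set P := binexp p n (fun j => (k <= j)%N%:R).
set Z := binexp p n _ => P0 ov.
have yH' : y%:R <= H%:R :> R by rewrite ler_nat ltnW.
have th1 : 0 <= 1 - theta by rewrite -drift mulr_ge0.
rewrite drift in var *; have v1 : (1 - theta) * (1 - p) <= 1 - theta.
  by rewrite ler_piMr // lerBlDr lerDl.
have Zle : Z <= H%:R ^+ 2 * P.
  apply: le_trans ov _; rewrite ler_wpM2r //.
  have sq1 : (1 - theta) ^+ 2 <= 1 by rewrite expr_le1 //; have := theta_gt0; lra.
  have sqH : 2 * 2 <= H%:R ^+ 2 :> R by rewrite expr2 ler_pM.
  by move: sq1 sqH v1; have := theta_gt0; lra.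
have hth : 0 <= theta * (H%:R - y%:R) by rewrite mulr_ge0 ?subr_ge0 // ltW.
have := sqr_ge0 theta; rewrite /e; lra.
Qed.

End Subcritical.

Section Supercritical.
Variable theta : R.
Hypothesis theta_gt0 : 0 < theta.
Hypothesis drift : n%:R * p = 1 + theta / 4.
Hypothesis theta_le1 : theta <= 1.
Hypothesis p_small : p <= 1 / 12.

Let alpha (y : nat) : R := (1 - expR (- (theta * y%:R))) / (1 - expR (- (theta * H%:R))).

(** Equivalently, exp(-theta W) is a submartingale. The exact exponent for a walk with
    drift theta/4 and variance 1 would be about theta/2; the factor 2 to spare makes
    crude estimates sufficient. *)
Lemma expRN_submartingale :
  expR (- theta) <= (1 + p * (expR (- theta) - 1)) ^+ n.
Proof.
set w := 1 - expR (- theta).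
have w0 : 0 <= w by rewrite subr_ge0 expR_le1 oppr_le0 ltW.
have w1 : w < 1 by rewrite /w; have := expR_gt0 (- theta); lra.
(* With the fourth power, the coefficient 3/8 of theta^2 exceeds the 1/3 needed for
   [w_le]; a square would only give 1/4. *)
have e4 : (1 - theta / 4) ^+ 4 <= expR (- theta).
  have -> : expR (- theta) = expR (- (theta / 4)) ^+ 4 by rewrite -expRM_natl; congr expR; field.
  rewrite lerXn2r ?nnegrE ?expR_ge0 //; first by have := theta_le1; lra.
  exact: expR_ge1Dx.
have w_le : w * (1 + theta / 3) <= theta.
  have : w <= 1 - (1 - theta / 4) ^+ 4 by rewrite /w; lra.
  move=> wq; apply: (@le_trans _ _ ((1 - (1 - theta / 4) ^+ 4) * (1 + theta / 3))).
    by rewrite ler_wpM2r //; have := theta_gt0; lra.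
  rewrite -subr_ge0; set X := (X in 0 <= X).
  have -> : X = theta ^+ 2 * (1 / 24 + theta * (1 / 16 - theta * (13 / 768) + theta ^+ 2 * (1 / 768))).
    by rewrite /X; field.
  have r0 : 0 <= 1 / 16 - theta * (13 / 768) + theta ^+ 2 * (1 / 768).
    by have := sqr_ge0 theta; have := theta_le1; lra.
  have := mulr_ge0 (ltW theta_gt0) r0; set Y := theta * _ => Y0.
  by apply: mulr_ge0; [exact: sqr_ge0 | lra].
set v := p * w.
have v1 : 0 < 1 - v by rewrite /v; have := p_small; have := p_ge0; nra.
have -> : 1 + p * (expR (- theta) - 1) = 1 - v by rewrite /v /w; ring.
have v_exp : expR (- (v / (1 - v))) <= 1 - v.
  rewrite expRN -[leRHS]invrK lef_pV2 ?posrE ?invr_gt0 ?expR_gt0 //.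
  rewrite [leLHS](_ : _ = 1 + v / (1 - v)); last by field; exact: lt0r_neq0.
  exact: expR_ge1Dx.
apply: (@le_trans _ _ (expR (- (v / (1 - v))) ^+ n)); last first.
  by rewrite lerXn2r ?nnegrE ?expR_ge0 // ltW.
rewrite -expRM_natl ler_expR mulrN lerN2 mulrA ler_pdivrMr // /v.
rewrite (mulrA n%:R) drift; have := p_small; have := p_ge0.
have := mulr_ge0 (ltW theta_gt0) w0; nra.
Qed.

Let H_gt0 : (0 < H)%N. Proof. exact: ltnW. Qed.

Let d_gt0 : 0 < 1 - expR (- (theta * H%:R)).
Proof. by rewrite subr_gt0 expR_lt1 oppr_lt0 mulr_gt0 ?ltr0n. Qed.

Let alpha_ge0 y : 0 <= alpha y.
Proof.
rewrite divr_ge0 ?(ltW d_gt0) // subr_ge0 -[leRHS]expR0 ler_expR oppr_le0.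
by rewrite mulr_ge0 // ltW.
Qed.

Let alpha_ge1 y : (H <= y)%N -> 1 <= alpha y.
Proof.
move=> Hy; rewrite ler_pdivlMr // mul1r lerD2l lerN2 ler_expR lerN2 ler_pM2l //.
by rewrite ler_nat.
Qed.

Let alpha_super y : (0 < y < H)%N -> binexp p n (fun j => alpha (y.-1 + j)%N) <= alpha y.
Proof.
move=> /andP[y0 yH]; rewrite /alpha; have := d_gt0; set d := 1 - expR (- (theta * H%:R)) => d0.
rewrite (eq_binexp (fun j => d^-1 * (1 + (- expR (- (theta * (y%:R - 1)))) * expR (- theta) ^+ j))); last first.
  move=> j; rewrite mulrC natr_pred_add // mulNr -expRM_natl -expRD; congr (_ * (_ - expR _)).
  by ring.
rewrite binexpZ binexpD binexp_cst binexpZ binexp_geom mulrC ler_pM2r ?invr_gt0 //.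
rewrite lerD2l mulNr lerN2.
apply: le_trans (ler_wpM2l (expR_ge0 _) expRN_submartingale).
by rewrite -expRD ler_expR; lra.
Qed.

Lemma escape_supercritical r :
  escape p n H r 1 <= (1 - expR (- theta)) / (1 - expR (- (theta * H%:R))) + stay p n H r 1.
Proof.
have -> : (1 - expR (- theta)) / (1 - expR (- (theta * H%:R))) = alpha 1%N.
  by rewrite /alpha mulr1.
exact: escape_split.
Qed.

(** Concavity of alpha between 0 and [H], obtained from the tangent of exp at [y]. *)
Let alpha_chord y : (y <= H)%N -> y%:R <= H%:R * alpha y.
Proof.
move=> yH; rewrite /alpha mulrA ler_pdivlMr //.
have Hn0 : (0 : R) < H%:R by rewrite ltr0n.
pose t : R := y%:R / H%:R.
have t0 : 0 <= t by rewrite divr_ge0.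
have t1 : t <= 1 by rewrite ler_pdivrMr // mul1r ler_nat.
have conv : expR (- (theta * y%:R)) <= 1 - t * (1 - expR (- (theta * H%:R))).
  have at0 := expR_ge1Dx (theta * y%:R).
  have atH := expR_ge1Dx (theta * y%:R - theta * H%:R).
  have E0 := expR_gt0 (- (theta * y%:R)).
  have m0 : expR (- (theta * y%:R)) * (1 + theta * y%:R) <= 1.
    rewrite -[leRHS]expR0 -(addNr (theta * y%:R)) expRD ler_pM2l //.
  have mH : expR (- (theta * y%:R)) * (1 + (theta * y%:R - theta * H%:R)) <= expR (- (theta * H%:R)).
    rewrite -[leRHS](_ : expR (- (theta * y%:R)) * expR (theta * y%:R - theta * H%:R) = _).
      by rewrite ler_pM2l.
    by rewrite -expRD; congr expR; ring.
  have ty : t * (theta * H%:R) = theta * y%:R by rewrite /t; field; exact: lt0r_neq0.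
  have := ler_wpM2l t0 mH; have := ler_wpM2l (_ : 0 <= 1 - t) m0.
  rewrite subr_ge0 t1 => /(_ isT); set E := expR (- (theta * y%:R)); set F := expR _.
  have : (1 - t) * (E * (1 + theta * y%:R)) + t * (E * (1 + (theta * y%:R - theta * H%:R)))
    = E + E * (theta * y%:R - t * (theta * H%:R)) by ring.
  rewrite ty subrr mulr0 addr0; lra.
have -> : y%:R = H%:R * t by rewrite /t; field; exact: lt0r_neq0.
rewrite -mulrA ler_pM2l //; move: conv.
have -> : H%:R * t = y%:R by rewrite /t; field; exact: lt0r_neq0.
lra.
Qed.

(** Wald's identity for the positive drift theta/4: the mean exit time is
    (E W - 1)/(theta/4), where W is the exit position, and E W is at most [H + 2]
    times the probability of leaving above [H]. The [2] bounds the mean overshoot. *)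
Lemma stay_supercritical T :
  T%:R * stay p n H T 1
  <= ((H%:R + 2) * ((1 - expR (- theta)) / (1 - expR (- (theta * H%:R)))) - 1) / (theta / 4).
Proof.
pose e (y : nat) : R := ((H%:R + 2) * alpha y - y%:R) / (theta / 4).
have th4 : 0 < theta / 4 by rewrite divr_gt0.
apply: (@le_trans _ _ (e 1%N)); last by rewrite /e /alpha mulr1.
apply: (stay_markov p01 (e := e)); last by rewrite H_gt1.
  move=> y yH; rewrite divr_ge0 ?(ltW th4) // subr_ge0.
  apply: le_trans (alpha_chord (ltnW yH)) _.
  by rewrite ler_wpM2r // lerDl.
move=> y yy; have /andP[y0 yH] := yy; set k := (H - y.-1)%N.
have above j : e (y.-1 + j)%N * (y.-1 + j < H)%N%:R
    <= (theta / 4)^-1 * (((H%:R + 2) * alpha (y.-1 + j)%N + (1 - y%:R))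
      + ((-1) * j%:R + ((k <= j)%N%:R * (j - k)%N%:R + (-2) * (k <= j)%N%:R))).
  rewrite /e mulrAC mulrC ler_pM2l ?invr_gt0 //.
  have [kj|jk] := leqP k j; last first.
    rewrite (_ : (_ < H)%N); last by rewrite /k in jk; lia.
    by rewrite natr_pred_add //=; lra.
  rewrite (_ : (_ < H)%N = false); last by rewrite /k in kj; lia.
  have -> : (j - k)%N%:R = y%:R - 1 + j%:R - H%:R :> R.
    rewrite -natr_pred_add // -natrB; last by rewrite /k in kj; lia.
    by congr (_%:R); rewrite /k in kj *; lia.
  have /alpha_ge1 : (H <= y.-1 + j)%N by rewrite /k in kj; lia.
  move=> a1; have H2 : 0 <= H%:R + 2 :> R by rewrite addr_ge0.
  have := ler_wpM2l H2 a1; rewrite /=; lra.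
rewrite -lerBrDl; apply: le_trans (binexp_le p01 _ above) _.
rewrite binexpZ !binexpD !binexpZ !binexp_cst binexp_mean drift.
have ov : binexp p n (fun j => (k <= j)%N%:R * (j - k)%N%:R)
    <= (1 + theta / 4) * binexp p n (fun j => (k <= j)%N%:R).
  rewrite -drift -binexp_mean; apply: (@binexp_overshoot _ _ p01 n k (fun j => j%:R)) => //.
  by move=> i j ij; rewrite ler_nat.
have P0 : 0 <= binexp p n (fun j => (k <= j)%N%:R) by apply: binexp_ge0.
have aS := alpha_super yy.
rewrite /e lerBrDr ler_pdivlMr // mulrDl mul1r mulrAC mulVf ?lt0r_neq0 // mul1r.
have H2 : 0 <= H%:R + 2 :> R by rewrite addr_ge0.
move: (ler_wpM2l H2 aS) ov P0; set A := binexp p n (fun j => alpha _).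
set P := binexp p n (fun j => (k <= j)%N%:R); set Z := binexp p n _ => HA ov P0.
have : theta * P <= P by rewrite ler_piMl.
lra.
Qed.

End Supercritical.
End Ruin.

(** * From one component to the largest *)

Section Largest.
Variables (R : realType) (n : nat) (p : R).
Hypothesis p01 : 0 <= p <= 1.

Lemma Gnp_expect_le (f g : graph n -> R) :
  (forall G, f G <= g G) -> Gnp_expect p f <= Gnp_expect p g.
Proof.
move=> fg; apply: ler_sum => G _; rewrite ler_wpM2l // prodr_ge0 // => e _.
by case/andP: p01 => p0 p1; case: ifP; rewrite ?subr_ge0.
Qed.

Lemma component_mem (G : graph n) (u v : 'I_n) :
  v \in component G u -> component G v = component G u.
Proof.
have sym : connect_sym (adj G).
  by apply: sym_connect_sym => x y; rewrite /adj finset.setUC.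
rewrite inE => uv; apply/setP => w; rewrite !inE.
by rewrite (same_connect sym uv).
Qed.

(** A component with at least [t] vertices contributes all its vertices to the sum. *)
Lemma largest_component_le (t : R) (G : graph n) : 0 < t ->
  t * (t <= (largest_component_size G)%:R)%R%:R
  <= \sum_(v : 'I_n) (t <= #|component G v|%:R)%R%:R.
Proof.
move=> t0; have [tL|_] := leP t _; last by rewrite mulr0 sumr_ge0.
rewrite mulr1; have [noC|C0] := posnP #|components G|.
  move: tL; rewrite /largest_component_size big_pred0 ?leNgt ?t0 // => C.
  by move/card0_eq: noC => /(_ C).
have [C CG LE] := @bigop.eq_bigmax_cond _ (mem (components G)) (fun C : {set 'I_n} => #|C|) C0.
rewrite /largest_component_size LE in tL.
case/imsetP: CG => u _ CE; apply: (le_trans tL).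
rewrite -sum1_card natr_sum [leRHS](bigID (mem C)) /= ler_wpDr ?sumr_ge0 //.
apply: ler_sum => v vC; rewrite (component_mem (u := u)) -CE //.
by rewrite tL.
Qed.

Lemma prob_largest_le (t : R) : 0 < t ->
  t * Gnp_prob p (fun G : graph n => t <= (largest_component_size G)%:R)
  <= \sum_(v : 'I_n) Gnp_prob p (fun G : graph n => t <= #|component G v|%:R).
Proof.
move=> t0; rewrite Gnp_probE; under eq_bigr do rewrite Gnp_probE.
rewrite /Gnp_expect exchange_big /= mulr_sumr; apply: ler_sum => G _.
rewrite -mulr_sumr mulrCA ler_wpM2l ?largest_component_le // prodr_ge0 // => e _.
by case/andP: p01 => p0 p1; case: ifP; rewrite ?subr_ge0.
Qed.

Lemma prob_component_le (t : R) (v : 'I_n) : 0 <= t ->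
  Gnp_prob p (fun G : graph n => t <= #|component G v|%:R)
  <= survival p (Num.truncn t) n 1.
Proof.
move=> t0; rewrite Gnp_probE -(prob_component _ _ v); apply: Gnp_expect_le => G.
have [tC|_] := leP t _; last by [].
by rewrite -(ler_nat R) (le_trans _ tC) // truncn_le.
Qed.

End Largest.

(** * The critical scaling *)

Section Scale.
Variable R : realType.

Import numFieldNormedType.Exports.
Local Open Scope classical_set_scope.
Local Open Scope ring_scope.

Definition eps (n : nat) : R := n%:R `^ (- (1 / 3)).

Lemma eps_gt0 n : (0 < n)%N -> 0 < eps n.
Proof. by move=> n0; rewrite powR_gt0 // ltr0n. Qed.

Lemma eps_cube n : (0 < n)%N -> n%:R * eps n ^+ 3 = 1.
Proof.
move=> n0; have n0' : (n%:R : R) != 0 by rewrite pnatr_eq0 -lt0n.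
rewrite /eps -powR_mulrn ?powR_ge0 // -powRrM.
have -> : - (1 / 3) * 3 = -1 :> R by field.
by rewrite powR_inv1 // divff.
Qed.

Lemma eps_sqrV n : (0 < n)%N -> n%:R `^ (2 / 3) = (eps n ^+ 2)^-1.
Proof.
move=> n0; rewrite /eps -powR_mulrn ?powR_ge0 // -powRrM -powRN.
by congr powR; field.
Qed.

Lemma cvg_eps : eps @ \oo --> (0 : R).
Proof.
apply/cvgr0Pnorm_lt => e e0; near=> n.
have n0 : (0 < n)%N by near: n; exact: nbhs_infty_ge.
rewrite gtr0_norm ?eps_gt0 // ltNge; apply/negP => een.
have e3 : 0 < e ^+ 3 by rewrite exprn_gt0.
have n_large : (e ^+ 3)^-1 + 1 <= n%:R by near: n; exact: nbhs_infty_ger.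
have : n%:R * e ^+ 3 <= 1.
  by rewrite -[leRHS](eps_cube n0) ler_wpM2l // lerXn2r // nnegrE ltW // eps_gt0.
have := ler_wpM2r (ltW e3) n_large.
rewrite mulrDl mulVf ?lt0r_neq0 // mul1r; move: e3; set x := e ^+ 3; lra.
Unshelve. all: by end_near. Qed.

Lemma cvg_truncn_scaled (c : R) : 0 <= c ->
  (Num.truncn (c * (eps n ^+ 2)^-1))%:R * eps n ^+ 2 @[n --> \oo] --> c.
Proof.
move=> c0; apply: (@squeeze_cvgr _ _ _ _ (fun n => c - eps n ^+ 2) (fun=> c)).
- near=> n.
  have e2 : 0 < eps n ^+ 2.
    by rewrite exprn_gt0 // eps_gt0 //; near: n; exact: nbhs_infty_ge.
  have cL : 0 <= c * (eps n ^+ 2)^-1 by rewrite mulr_ge0 // invr_ge0 ltW.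
  have /andP[lo hi] := truncn_itv cL.
  rewrite -[X in _ <= _ <= X](mulfVK (lt0r_neq0 e2)) ler_pM2r // lo andbT.
  rewrite lerBlDr -[X in _ + X]mul1r -mulrDl -ler_pdivrMr //.
  by rewrite natr1 ltW.
- rewrite -[X in _ --> X]subr0; apply: cvgB; first exact: cvg_cst.
  rewrite -[X in _ --> X](mulr0 0); under eq_fun do rewrite expr2.
  by apply: cvgM; exact: cvg_eps.
- exact: cvg_cst.
Unshelve. all: by end_near. Qed.

Lemma cvg_truncnS_eps :
  (Num.truncn (eps n)^-1).+1%:R * eps n @[n --> \oo] --> (1 : R).
Proof.
apply: (@squeeze_cvgr _ _ _ _ (fun=> 1) (fun n => 1 + eps n)).
- near=> n.
  have e0 : 0 < eps n by rewrite eps_gt0 //; near: n; exact: nbhs_infty_ge.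
  have eV : 0 <= (eps n)^-1 by rewrite invr_ge0 ltW.
  have /andP[lo hi] := truncn_itv eV.
  rewrite -ler_pdivrMr // mul1r ltW //= -natr1 mulrDl mul1r lerD2r.
  by rewrite -ler_pdivlMr // mul1r.
- exact: cvg_cst.
- rewrite -[X in _ --> X]addr0; apply: cvgD; first exact: cvg_cst.
  exact: cvg_eps.
Unshelve. all: by end_near. Qed.

End Scale.

(** * Asymptotics in the critical window *)

Section Asymptotics.
Variables (R : realType) (lambda A : R).
Implicit Type n : nat.
Import numFieldNormedType.Exports.
Local Open Scope classical_set_scope.
Local Open Scope ring_scope.

Notation eps := (@eps R).
Notation p := (@critical_p R lambda).

(** The factor 1 puts [ruin_time] in the form of [cvg_truncn_scaled]. *)
Definition ruin_time n : nat := Num.truncn (1 * (eps n ^+ 2)^-1).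
Definition ruin_level n : nat := (Num.truncn (eps n)^-1).+1.
Definition target n : nat := Num.truncn (A * (eps n ^+ 2)^-1).

Lemma critical_pE n : (0 < n)%N -> p n = (1 + lambda * eps n) * eps n ^+ 3.
Proof.
move=> n0; have nn : (n%:R : R) != 0 by rewrite pnatr_eq0 -lt0n.
have inv_n : n%:R^-1 = eps n ^+ 3 by apply: (mulfI nn); rewrite divff // eps_cube.
by rewrite /critical_p inv_n.
Qed.

Lemma critical_drift n : (0 < n)%N -> n%:R * p n = 1 + lambda * eps n.
Proof.
by move=> n0; rewrite critical_pE // mulrCA eps_cube // mulr1.
Qed.

Lemma near_eps (e : R) : 0 < e -> \forall n \near \oo, (0 < n)%N /\ 0 < eps n < e.
Proof.
move=> e0; near=> n.
have n0 : (0 < n)%N by near: n; exact: nbhs_infty_ge.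
split=> //; rewrite eps_gt0 //=; near: n.
exact: (cvgr_lt _ (@cvg_eps R) _ e0).
Unshelve. all: by end_near. Qed.

Lemma near_critical_p (e : R) : 0 < e -> \forall n \near \oo, 0 <= p n <= e.
Proof.
move=> e0; near=> n.
have [n0 /andP[en0 en1]] : (0 < n)%N /\ 0 < eps n < Num.min (1 / (1 + `|lambda|)) (e / 2).
  near: n; apply: near_eps.
  by rewrite lt_min !divr_gt0 // ltr_pwDl.
rewrite lt_min in en1; case/andP: en1 => en1 en2.
have l1 : 0 < 1 + `|lambda| by rewrite ltr_pwDl.
rewrite critical_pE //; set d := lambda * eps n.
have : `|d| < 1.
  rewrite normrM (gtr0_norm en0) -(mulVf (lt0r_neq0 l1)).
  rewrite ltr_pdivlMr // in en1.
  rewrite mulVf ?lt0r_neq0 //; have := normr_ge0 lambda; lra.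
rewrite ltr_norml => /andP[d1 d2].
have small : eps n ^+ 3 <= e / 2.
  apply: (@le_trans _ _ (eps n)); last exact: ltW.
  rewrite -[leRHS]mulr1 exprS ler_pM2l // exprn_ile1 ?ltW //.
  apply: lt_le_trans en1 _; rewrite ler_pdivrMr // mul1r lerDl //.
have c0 : 0 < eps n ^+ 3 by rewrite exprn_gt0.
apply/andP; split; first by rewrite mulr_ge0 ?ltW //; lra.
apply: (@le_trans _ _ (2 * eps n ^+ 3)); first by rewrite ler_pM2r //; lra.
by lra.
Unshelve. all: by end_near. Qed.

(** An upper bound for the exponent of the Chernoff bound with parameter a = x e, written
    in the rescaled number of steps k and level h, which converge. *)
Definition rate (x e k h : R) : R :=
  2 * x * (1 + lambda * e) * e + k * (lambda * x + x ^+ 2 + lambda * x ^+ 2 * e)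
  - (1 + lambda * e) * x * (k * (k - e ^+ 2) / 2) + x * h.

Lemma exponent_le_rate (x e k h : R) (c := expR (x * e) - 1) :
  0 < e -> 0 <= x -> x * e <= 1 / 3 -> 0 <= 1 + lambda * e -> 1 <= k ->
  (1 + lambda * e) * c
  + ((k * ((1 + lambda * e) * c - x * e)
      - (1 + lambda * e) * e ^+ 3 * c * (k * (k - 1) / 2)) + x * e * h)
  <= rate x e (k * e ^+ 2) (h * e).
Proof.
move=> e0 x0 xe q0 k1.
have a0 : 0 <= x * e by rewrite mulr_ge0 // ltW.
have c_le : c <= x * e + (x * e) ^+ 2 by apply: expR_sub1_le; rewrite a0.
have c_ge : x * e <= c by rewrite /c; have := expR_ge1Dx (x * e); lra.
set q := 1 + lambda * e in q0 *.
have c_le2 : c <= 2 * (x * e).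
  apply: le_trans c_le _; rewrite expr2.
  by have : x * e * (x * e) <= x * e * 1; [rewrite ler_wpM2l //|]; lra.
have t1 : q * c <= q * (2 * (x * e)) by rewrite ler_wpM2l.
have t2 : k * (q * c) <= k * (q * (x * e + (x * e) ^+ 2)).
  by rewrite ler_wpM2l ?ler_wpM2l //; lra.
have kk : 0 <= q * e ^+ 3 * (k * (k - 1) / 2).
  apply: mulr_ge0; first by rewrite mulr_ge0 ?exprn_ge0 // ltW.
  by rewrite divr_ge0 // mulr_ge0 ?subr_ge0 //; lra.
have t3 : q * e ^+ 3 * (k * (k - 1) / 2) * (x * e) <= q * e ^+ 3 * (k * (k - 1) / 2) * c.
  by rewrite ler_wpM2l.
rewrite /rate -/q; move: t1 t2 t3; clear kk; rewrite /q; lra.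
Qed.

Lemma cvg_rate (x : R) (k h : nat -> R) (k0 h0 : R) :
  k n @[n --> \oo] --> k0 -> h n @[n --> \oo] --> h0 ->
  rate x (eps n) (k n) (h n) @[n --> \oo] --> rate x 0 k0 h0.
Proof.
move=> ck ch; have ce := @cvg_eps R; rewrite /rate.
have cc (c : R) : (c : R) @[n --> \oo] --> c by exact: cvg_cst.
have ce2 : eps n ^+ 2 @[n --> \oo] --> (0 ^+ 2 : R).
  by rewrite expr2; under eq_fun do rewrite expr2; apply: cvgM.
by repeat first [exact: ck | exact: ch | exact: ce | exact: ce2 | exact: cc
  | apply: cvgD | apply: cvgB | apply: cvgM | apply: cvgN].
Qed.

Let Q : R := (A - 1) ^+ 2 / 2 - (A - 1) * lambda - 2.

(** The Chernoff parameter is x eps with x = Q/(2A). The limiting exponent is smaller than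
    -Q^2/(4A) by x + x^2; half of x is kept as the factor exp(-Q/(4A)), which
    [near_tail_bounds] spends on the errors of the first phase. *)
Lemma near_survival : 1 < A -> 0 < Q ->
  \forall n \near \oo, survival (p n) (target n) n 1
    <= tail_exp lambda A * expR (- (Q / (4 * A)))
       * escape (p n) n (ruin_level n) (ruin_time n) 1.
Proof.
move=> A1 Q0; have A0 : 0 < A by apply: lt_trans A1.
have [x xE x0] : exists2 x : R, x = Q / (2 * A) & 0 < x.
  by exists (Q / (2 * A)); rewrite // divr_gt0 // mulr_gt0.
have cT := @cvg_truncn_scaled R 1 ler01.
have cK := @cvg_truncn_scaled R A (ltW A0).
have cKT : (target n)%:R * eps n ^+ 2 - (ruin_time n)%:R * eps n ^+ 2 @[n --> \oo]
    --> A - 1 by apply: cvgB.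
have cR := cvg_rate (x := x) cKT (@cvg_truncnS_eps R).
have goal_rate : - (Q ^+ 2 / (4 * A)) - Q / (4 * A) > rate x 0 (A - 1) 1.
  rewrite -subr_gt0; set X := (X in 0 < X).
  have -> : X = x / 2 + x ^+ 2.
    by rewrite /X /rate xE /Q; field; rewrite lt0r_neq0.
  by have := exprn_gt0 2 x0; lra.
have l1 : 0 < 1 + `|lambda| by rewrite ltr_pwDl.
near=> n.
have p01 : 0 <= p n <= 1 by near: n; apply: near_critical_p.
have [n0 /andP[e0 e1]] : (0 < n)%N /\ 0 < eps n < Num.min (1 / (3 * x)) (Num.min 1 (1 / (1 + `|lambda|))).
  near: n; apply: near_eps.
  by rewrite !lt_min ltr01 /= !divr_gt0 // mulr_gt0.
rewrite !lt_min in e1; case/and3P: e1 => e1 e2 e3.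
have xe : x * eps n <= 1 / 3.
  by move: e1; rewrite ltr_pdivlMr ?mulr_gt0 // => e1; lra.
have q0 : 0 <= 1 + lambda * eps n.
  rewrite ltr_pdivlMr // in e3.
  have := ler_norm (- lambda); rewrite normrN => /(ler_wpM2r (ltW e0)); lra.
have KT : (target n)%:R * eps n ^+ 2 - (ruin_time n)%:R * eps n ^+ 2 > 0.
  by near: n; apply: (cvgr_gt _ cKT); rewrite subr_gt0.
have rate_le : rate x (eps n) ((target n)%:R * eps n ^+ 2 - (ruin_time n)%:R * eps n ^+ 2)
   ((ruin_level n)%:R * eps n) <= - (Q ^+ 2 / (4 * A)) - Q / (4 * A).
  by near: n; exact: (cvgr_le _ cR _ goal_rate).
have e20 : 0 < eps n ^+ 2 by rewrite exprn_gt0.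
have KT' : (ruin_time n < target n)%N.
  by rewrite -(ltr_nat R) -subr_gt0; move: KT; rewrite -mulrBl pmulr_lgt0.
rewrite -mulrBl -natrB ?(ltnW KT') // in rate_le.
set k := (target n - ruin_time n)%N in rate_le.
have k0 : (0 < k)%N by rewrite subn_gt0.
have H1 : (1 < ruin_level n)%N.
  by rewrite ltnS truncn_gt0 invf_ge1 // ltW.
have -> : target n = (ruin_time n + k)%N by rewrite subnKC // ltnW.
pose c := expR (x * eps n) - 1.
pose C := expR (k%:R * (n%:R * (p n * c) - x * eps n) - p n * c * (k%:R * (k%:R - 1) / 2)).
have surv N y : (N <= n)%N -> survival (p n) k N y <= C * expR (x * eps n * y%:R).
  move=> Nn; apply: le_trans (survival_exp p01 _ _ _ (mulr_ge0 (ltW x0) (ltW e0))) _.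
  rewrite -expRD ler_expR -/c; set Z := p n * c * _.
  suff : k%:R * (N%:R * (p n * c) - x * eps n) <= k%:R * (n%:R * (p n * c) - x * eps n) by lra.
  rewrite ler_wpM2l // lerD2r ler_wpM2r ?ler_nat //.
  rewrite mulr_ge0 ?subr_ge0 //; first by case/andP: p01.
  by rewrite -expR0 ler_expR mulr_ge0 // ltW.
have a0 : 0 <= x * eps n by rewrite mulr_ge0 // ltW.
have C0 : 0 <= C by apply: expR_ge0.
have := survival_escape p01 (ruin_time n) a0 C0 k0 (leqnn n) H1 surv.
move=> surv_le; apply: (le_trans surv_le).
rewrite ler_wpM2r //; first by case/andP: (escape01 n (ruin_level n) p01 (ruin_time n) 1).
rewrite /tail_exp -/Q -!expRD ler_expR; apply: le_trans rate_le.
apply: le_trans (exponent_le_rate _ e0 (ltW x0) xe q0 _); last by rewrite ler1n.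
by rewrite -/c !(mulrA n%:R (p n)) critical_drift // critical_pE.
Unshelve. all: by end_near. Qed.

Lemma near_level : \forall n \near \oo,
  [/\ (0 < n)%N, 0 < eps n, (1 < ruin_level n)%N & 1 <= (ruin_level n)%:R * eps n].
Proof.
near=> n.
have [n0 /andP[e0 e1]] : (0 < n)%N /\ 0 < eps n < 1 by near: n; apply: near_eps.
split=> //; first by rewrite ltnS truncn_gt0 invf_ge1 // ltW.
by rewrite -ler_pdivrMr // mul1r ltW // truncnS_gt.
Unshelve. all: by end_near. Qed.

(** With theta = 4 lambda eps, the probability of leaving above the level is at most u eps,
    where u is the first term of the constant, and the probability of not having left
    is asymptotically at most (u - 1) eps/lambda. As (1 + v) e^(-v) <= 1, the latter
    is at most 4 eps, well below 16 eps. *)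
Lemma near_escape_supercritical : 0 < lambda ->
  \forall n \near \oo, escape (p n) n (ruin_level n) (ruin_time n) 1
    <= (4 * lambda / (1 - expR (- (4 * lambda))) + 16) * eps n.
Proof.
move=> l0; have l4 : 0 < 4 * lambda by rewrite mulr_gt0.
set d := 1 - expR (- (4 * lambda)).
have d0 : 0 < d by rewrite subr_gt0 expR_lt1 oppr_lt0.
set u := 4 * lambda / d; have u0 : 0 < u by rewrite divr_gt0.
have u_le : u - 1 <= 4 * lambda.
  have ev : expR (- (4 * lambda)) * expR (4 * lambda) = 1 by rewrite -expRD addNr expR0.
  have := ler_wpM2l (expR_ge0 (- (4 * lambda))) (expR_ge1Dx (4 * lambda)).
  rewrite ev => chord; rewrite lerBlDr ler_pdivrMr // /d; lra.
have cT := @cvg_truncn_scaled R 1 ler01.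
have climit : u * ((ruin_level n)%:R * eps n + 2 * eps n) - 1
    - 16 * lambda * ((ruin_time n)%:R * eps n ^+ 2) @[n --> \oo]
    --> u * (1 + 2 * 0) - 1 - 16 * lambda * 1.
  apply: cvgB.
    apply: cvgB; last exact: cvg_cst.
    apply: cvgM; first exact: cvg_cst.
    apply: cvgD; first exact: cvg_truncnS_eps.
    by apply: cvgM; [exact: cvg_cst | exact: cvg_eps].
  by apply: cvgM; first exact: cvg_cst.
have limit_lt : u * (1 + 2 * 0) - 1 - 16 * lambda * 1 < 0 by lra.
near=> n.
have [n0 e0 H1 He] : [/\ (0 < n)%N, 0 < eps n, (1 < ruin_level n)%N
  & 1 <= (ruin_level n)%:R * eps n] by near: n; apply: near_level.
have [_ /andP[_ e1]] : (0 < n)%N /\ 0 < eps n < 1 / (4 * lambda).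
  by near: n; apply: near_eps; rewrite divr_gt0.
have /andP[p0 p1] : 0 <= p n <= 1 / 12 by near: n; apply: near_critical_p; rewrite divr_gt0.
have p01 : 0 <= p n <= 1 by rewrite p0; lra.
have T0 : 0 < (ruin_time n)%:R * eps n ^+ 2 :> R.
  by near: n; exact: (cvgr_gt _ cT _ ltr01).
have bound : u * ((ruin_level n)%:R * eps n + 2 * eps n) - 1
    - 16 * lambda * ((ruin_time n)%:R * eps n ^+ 2) <= 0.
  by near: n; exact: (cvgr_le _ climit _ limit_lt).
pose theta := 4 * lambda * eps n.
have th0 : 0 < theta by rewrite mulr_gt0.
have th1 : theta <= 1 by rewrite /theta; rewrite ltr_pdivlMr // in e1; lra.
have drift : n%:R * p n = 1 + theta / 4 by rewrite critical_drift // /theta; field.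
set H := ruin_level n in H1 He bound *; set T := ruin_time n in T0 bound *.
have a1 : (1 - expR (- theta)) / (1 - expR (- (theta * H%:R))) <= u * eps n.
  have dle : d <= 1 - expR (- (theta * H%:R)).
    by rewrite lerD2l lerN2 ler_expR lerN2 /theta -mulrA (mulrC (eps n)) ler_peMr // ltW.
  apply: (@le_trans _ _ (theta / d)); last by rewrite /theta /u mulrAC.
  apply: ler_pM => //; first by rewrite subr_ge0 expR_le1 oppr_le0 ltW.
  - by rewrite invr_ge0 (le_trans (ltW d0)).
  - by have := expR_ge1Dx (- theta); lra.
  - by rewrite lef_pV2 // posrE // (lt_le_trans d0).
apply: le_trans (escape_supercritical p01 H1 th0 drift th1 p1 T) _.
rewrite [leRHS]mulrDl; apply: lerD => //.
have := stay_supercritical p01 H1 th0 drift th1 p1 T.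
set s := stay _ _ _ _ _ => sT.
have T0' : 0 < T%:R :> R by move: T0; rewrite pmulr_lgt0 // exprn_gt0.
rewrite -(ler_pM2l T0'); apply: le_trans sT _.
rewrite ler_pdivrMr ?divr_gt0 //.
have H2 : 0 <= H%:R + 2 :> R by rewrite addr_ge0.
have := ler_wpM2l H2 a1; move: bound; rewrite /theta.
by set X := (_ / _); set t := T%:R; lra.
Unshelve. all: by end_near. Qed.

(** With theta = -lambda eps, the probability of not having left the strip is asymptotically
    at most 4 eps and at most -eps/lambda. The first leaves room below 5 eps, the second
    leaves none, hence the factor [r]. *)
Lemma near_escape_subcritical (r : R) : lambda < 0 -> 1 < r ->
  \forall n \near \oo, escape (p n) n (ruin_level n) (ruin_time n) 1
    <= (- 2 * lambda / (expR (- lambda) - 1) + Num.min 5 (- (1 / lambda))) * r * eps n.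
Proof.
move=> l0 r1; have ml0 : 0 < - lambda by rewrite oppr_gt0.
set d := expR (- lambda) - 1.
have d0 : 0 < d by rewrite subr_gt0 expR_gt1.
have cT := @cvg_truncn_scaled R 1 ler01.
have r0 : 0 < r by apply: lt_trans r1.
near=> n.
have [n0 e0 H1 He] : [/\ (0 < n)%N, 0 < eps n, (1 < ruin_level n)%N
  & 1 <= (ruin_level n)%:R * eps n] by near: n; apply: near_level.
have [_ /andP[_ e1]] : (0 < n)%N /\ 0 < eps n < 1 / 8 * (- lambda)^-1.
  by near: n; apply: near_eps; rewrite mulr_gt0 ?invr_gt0 ?divr_gt0.
have /andP[p0 p1] : 0 <= p n <= 1 / 12 by near: n; apply: near_critical_p; rewrite divr_gt0.
have p01 : 0 <= p n <= 1 by rewrite p0; lra.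
have T0 : 9 / 10 < (ruin_time n)%:R * eps n ^+ 2 :> R.
  by near: n; apply: (cvgr_gt _ cT); lra.
have Tr : r^-1 < (ruin_time n)%:R * eps n ^+ 2 :> R.
  by near: n; apply: (cvgr_gt _ cT); rewrite invf_lt1.
have Hh : (ruin_level n)%:R * eps n < 9 / 8 :> R.
  by near: n; apply: (cvgr_lt _ (@cvg_truncnS_eps R)); lra.
pose theta := - lambda * eps n.
have th0 : 0 < theta by rewrite mulr_gt0.
have th1 : theta <= 1 / 8 by rewrite /theta mulrC; rewrite ltr_pdivlMr // in e1; rewrite ltW.
have drift : n%:R * p n = 1 - theta by rewrite critical_drift // /theta; ring.
set H := ruin_level n in H1 He Hh *; set T := ruin_time n in T0 Tr *.
have e20 : 0 < eps n ^+ 2 by rewrite exprn_gt0.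
have T0' : 0 < T%:R :> R.
  by have : 0 < T%:R * eps n ^+ 2 by [lra]; rewrite pmulr_lgt0.
have a1 : (expR theta - 1) / (expR (theta * H%:R) - 1) <= - 2 * lambda / d * r * eps n.
  have dle : d <= expR (theta * H%:R) - 1.
    by rewrite lerD2r ler_expR /theta -mulrA (mulrC (eps n)) ler_peMr // ltW.
  apply: (@le_trans _ _ (2 * theta / d)).
    apply: ler_pM => //; first by rewrite subr_ge0 -[leLHS]expR0 ler_expR ltW.
    - by rewrite invr_ge0 (le_trans (ltW d0)).
    - apply: le_trans (expR_sub1_le _) _; first by rewrite ltW //=; lra.
      by have : theta * theta <= theta * 1; [rewrite ler_wpM2l // ?ltW //|]; rewrite ?expr2; lra.
    - by rewrite lef_pV2 // posrE // (lt_le_trans d0).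
  have -> : - 2 * lambda / d * r * eps n = 2 * theta / d * r by rewrite /theta; ring.
  by rewrite ler_peMr ?ltW // divr_gt0 // mulr_gt0.
apply: le_trans (escape_subcritical p01 H1 th0 drift T) _.
have distr (a b : R) : (a + b) * r * eps n = a * r * eps n + b * r * eps n by ring.
rewrite distr; apply: lerD => //.
have s1 := stay_subcritical p01 H1 th0 drift T.
have var : 1 / 2 <= n%:R * p n * (1 - p n) by rewrite drift; nra.
have s2 := stay_near_critical p01 H1 th0 drift T var.
set s := stay _ _ _ _ _ in s1 s2 *.
rewrite -(ler_pM2l T0').
have [_|_] := leP (5 : R) (- (1 / lambda)).
  apply: le_trans s2 _; rewrite -(ler_pM2r e0).
  have -> : T%:R * (5 * r * eps n) * eps n = r * (5 * (T%:R * eps n ^+ 2)) by ring.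
  have t5 : 9 / 2 <= 5 * (T%:R * eps n ^+ 2) by lra.
  apply: (@le_trans _ _ (9 / 2)); first by lra.
  by apply: le_trans t5 _; rewrite ler_peMl ?ltW //; lra.
apply: le_trans s1 _.
have -> : T%:R * (- (1 / lambda) * r * eps n) = r * (T%:R * eps n ^+ 2) * theta^-1.
  by rewrite /theta; field; rewrite lt0r_neq0 //= lt_eqF.
rewrite -[leLHS]mul1r ler_pM2r ?invr_gt0 // mulrC -ler_pdivrMr // div1r.
exact: ltW.
Unshelve. all: by end_near. Qed.

Lemma prob_largest_from_component n (c : R) : (0 < n)%N -> 0 < A -> 0 <= p n <= 1 ->
  (forall v : 'I_n, Gnp_prob (p n)
     (fun G : graph n => A * n%:R `^ (2 / 3) <= #|component G v|%:R)
     <= c * n%:R `^ (- (1 / 3)) * tail_exp lambda A) ->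
  Gnp_prob (p n)
    (fun G : graph n => A * n%:R `^ (2 / 3) <= (largest_component_size G)%:R)
  <= c / A * tail_exp lambda A.
Proof.
move=> n0 A0 p01 Hv; set t := A * _.
have e0 : 0 < eps n by apply: eps_gt0.
have e20 : 0 < (eps n ^+ 2)^-1 by rewrite invr_gt0 exprn_gt0.
have t0 : 0 < t by rewrite mulr_gt0 // eps_sqrV.
rewrite -(ler_pM2l t0); apply: le_trans (prob_largest_le n p01 t0) _.
apply: (@le_trans _ _ (\sum_(v : 'I_n) c * eps n * tail_exp lambda A)).
  by apply: ler_sum => v _; apply: Hv.
rewrite sumr_const card_ord -mulr_natl /t eps_sqrV //.
have -> : A * (eps n ^+ 2)^-1 * (c / A * tail_exp lambda A)
   = (eps n ^+ 2)^-1 * (c * tail_exp lambda A) * 1.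
  by field; rewrite !lt0r_neq0.
rewrite -[X in _ <= _ * X](eps_cube R n0).
by apply: eq_ler; field; rewrite lt0r_neq0.
Qed.

(** The two phases together; the factor exp(Q/(4A)) tolerated in the first is the one saved
    in [near_survival]. *)
Lemma near_tail_bounds (c : R) : 1 < A -> 0 < Q ->
  (\forall n \near \oo, escape (p n) n (ruin_level n) (ruin_time n) 1
    <= c * expR (Q / (4 * A)) * eps n) ->
  \forall n \near \oo,
    (forall v : 'I_n, Gnp_prob (p n)
       (fun G : graph n => A * n%:R `^ (2 / 3) <= #|component G v|%:R)
       <= c * n%:R `^ (- (1 / 3)) * tail_exp lambda A) /\
    Gnp_prob (p n)
      (fun G : graph n => A * n%:R `^ (2 / 3) <= (largest_component_size G)%:R)
    <= c / A * tail_exp lambda A.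
Proof.
move=> A1 Q0 esc; have A0 : 0 < A by apply: lt_trans A1.
near=> n.
have [n0 /andP[e0 _]] : (0 < n)%N /\ 0 < eps n < 1 by near: n; apply: near_eps.
have p01 : 0 <= p n <= 1 by near: n; apply: near_critical_p.
have surv : survival (p n) (target n) n 1
    <= tail_exp lambda A * expR (- (Q / (4 * A)))
       * escape (p n) n (ruin_level n) (ruin_time n) 1.
  by near: n; apply: near_survival.
have escn : escape (p n) n (ruin_level n) (ruin_time n) 1
    <= c * expR (Q / (4 * A)) * eps n by near: n.
have comp (v : 'I_n) : Gnp_prob (p n)
    (fun G : graph n => A * n%:R `^ (2 / 3) <= #|component G v|%:R)
    <= c * n%:R `^ (- (1 / 3)) * tail_exp lambda A.
  apply: le_trans (prob_component_le p01 v _) _.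
    by rewrite mulr_ge0 ?powR_ge0 // ltW.
  rewrite eps_sqrV //; apply: le_trans surv _.
  have tail0 : 0 <= tail_exp lambda A * expR (- (Q / (4 * A))) by rewrite mulr_ge0 ?expR_ge0.
  apply: le_trans (ler_wpM2l tail0 escn) _.
  apply: eq_ler; rewrite expRN -/(eps n).
  by field; rewrite lt0r_neq0 // expR_gt0.
by split=> //; apply: prob_largest_from_component.
Unshelve. all: by end_near. Qed.

Lemma supercritical_tail_bounds : 0 < lambda -> 2 * lambda + 3 < A ->
  \forall n \near \oo,
    (forall v : 'I_n, Gnp_prob (p n)
       (fun G : graph n => A * n%:R `^ (2 / 3) <= #|component G v|%:R)
       <= (4 * lambda / (1 - expR (- (4 * lambda))) + 16)
          * n%:R `^ (- (1 / 3)) * tail_exp lambda A) /\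
    Gnp_prob (p n)
      (fun G : graph n => A * n%:R `^ (2 / 3) <= (largest_component_size G)%:R)
    <= (4 * lambda / (1 - expR (- (4 * lambda))) + 16) / A * tail_exp lambda A.
Proof.
move=> l0 A_gt; have A1 : 1 < A by lra.
have Q0 : 0 < Q by rewrite /Q; nra.
apply: near_tail_bounds => //; near=> n.
have [n0 /andP[e0 _]] : (0 < n)%N /\ 0 < eps n < 1 by near: n; apply: near_eps.
apply: (@le_trans _ _ ((4 * lambda / (1 - expR (- (4 * lambda))) + 16) * eps n)).
  by near: n; apply: near_escape_supercritical.
rewrite ler_pM2r // ler_peMr //; last first.
  by rewrite -[leLHS]expR0 ler_expR divr_ge0 ?mulr_ge0 ?ltW // (lt_trans ltr01).
rewrite addr_ge0 // divr_ge0 ?subr_ge0 ?expR_le1 ?oppr_le0 ?mulr_ge0 //; exact: ltW.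
Unshelve. all: by end_near. Qed.

Lemma subcritical_tail_bounds : lambda < 0 -> 3 < A ->
  \forall n \near \oo,
    (forall v : 'I_n, Gnp_prob (p n)
       (fun G : graph n => A * n%:R `^ (2 / 3) <= #|component G v|%:R)
       <= (- 2 * lambda / (expR (- lambda) - 1) + Num.min 5 (- (1 / lambda)))
          * n%:R `^ (- (1 / 3)) * tail_exp lambda A) /\
    Gnp_prob (p n)
      (fun G : graph n => A * n%:R `^ (2 / 3) <= (largest_component_size G)%:R)
    <= (- 2 * lambda / (expR (- lambda) - 1) + Num.min 5 (- (1 / lambda))) / A
       * tail_exp lambda A.
Proof.
move=> l0 A_gt; have A1 : 1 < A by lra.
have Q0 : 0 < Q by rewrite /Q; nra.
apply: near_tail_bounds => //; apply: near_escape_subcritical => //.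
by rewrite expR_gt1 divr_gt0 // mulr_gt0 // (lt_trans ltr01).
Qed.

End Asymptotics.

Theorem theorem7 (R : realType) (lambda A : R) :
  (0 < lambda -> 2 * lambda + 3 < A ->
    exists n0 : nat, forall n : nat, (n0 <= n)%N ->
      (forall v : 'I_n,
        Gnp_prob (critical_p lambda n)
          (fun G : graph n => A * n%:R `^ (2 / 3) <= #|component G v|%:R)
        <= (4 * lambda / (1 - expR (- (4 * lambda))) + 16)
           * n%:R `^ (- (1 / 3)) * tail_exp lambda A) /\
      Gnp_prob (critical_p lambda n)
        (fun G : graph n =>
           A * n%:R `^ (2 / 3) <= (largest_component_size G)%:R)
      <= (4 * lambda / (A * (1 - expR (- (4 * lambda)))) + 16 / A)
         * tail_exp lambda A) /\
  (lambda < 0 -> 3 < A ->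
    exists n0 : nat, forall n : nat, (n0 <= n)%N ->
      (forall v : 'I_n,
        Gnp_prob (critical_p lambda n)
          (fun G : graph n => A * n%:R `^ (2 / 3) <= #|component G v|%:R)
        <= (- 2 * lambda / (expR (- lambda) - 1) + Num.min 5 (- (1 / lambda)))
           * n%:R `^ (- (1 / 3)) * tail_exp lambda A) /\
      Gnp_prob (critical_p lambda n)
        (fun G : graph n =>
           A * n%:R `^ (2 / 3) <= (largest_component_size G)%:R)
      <= (- 2 * lambda / (A * (expR (- lambda) - 1))
            + Num.min 5 (- (1 / lambda)))
         * tail_exp lambda A).
Proof.
split=> [l0 A_gt|l0 A_gt].
  have [N _ bounds] := supercritical_tail_bounds l0 A_gt.
  exists N => n /bounds [comp largest]; split=> //.
  apply: le_trans largest _; apply: eq_ler; congr (_ * _); rewrite mulrDl invfM; ring.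
have [N _ bounds] := subcritical_tail_bounds l0 A_gt.
exists N => n /bounds [comp largest]; split=> //.
apply: le_trans largest _; rewrite ler_wpM2r ?expR_ge0 // mulrDl lerD //.
  by apply: eq_ler; rewrite invfM; ring.
rewrite ler_pdivrMr ?ler_peMr //; try lra.
by rewrite le_min; apply/andP; split=> //; rewrite oppr_ge0 mul1r invr_le0 ltW.
Qed.
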